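(* Let $\mathbf{f}=(f_1,\dots,f_s)$ be a regular sequence in $R=\mathbb{Z}_{N}[\mathbb{Z}^D]$ and set $S:=R/(\mathbf f)$. For $1\le j\le s-1$, the Koszul-complex model $\mathrm{KC}_j^{(D,s)}(\mathbf{f}; \mathbb{Z}_N)$, with $\varphi_X=\partial_j^\dagger$ and $\varphi_Z=\partial_{j+1}$, is topological. Furthermore, for $\ell>0$, $$\operatorname{Ext}_R^\ell(\overline{\operatorname{coker}\varphi_X}, R)\cong_R\begin{cases}S,&\ell=j,\\0,&\ell\ne j,\end{cases}\qquad \operatorname{Ext}_R^{\ell}(\overline{\operatorname{coker}\varphi_Z}, R)\cong_R\begin{cases}\overline{S},&\ell=s-j,\\0,&\ell\neq s-j.\end{cases}$$
   Context: $R=\mathbb Z_N[x_1^{\pm1},\dots,x_D^{\pm1}]$ with $\mathbb Z_N$-linear involution $\overline{x^{\mathbf v}}=x^{-\mathbf v}$. For an $R$-module $M$, $\overline M$ is the same abelian group with action $r\ast m=\overline r\,m$ (so $\overline S\cong R/(\overline{f_1},\dots,\overline{f_s})$), and $M^\dagger=\operatorname{Hom}_R(\overline M,R)$; for matrices $\varphi^\dagger=\overline\varphi^{\mathsf T}$. A sequence $(f_1,\dots,f_s)$ is regular if $f_1$ is a non-zero-divisor in $R$ and each $f_i$ ($2\le i\le s$) is a non-zero-divisor on $R/(f_1,\dots,f_{i-1})$. The Koszul complex: $K_i(\mathbf f)=\bigwedge^iR^s$, $\partial_i(e_{a_1}\wedge\cdots\wedge e_{a_i})=\sum_{k=1}^i(-1)^{k-1}f_{a_k}e_{a_1}\wedge\cdots\widehat{e_{a_k}}\cdots\wedge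 e_{a_i}$. The degree-$j$ Koszul-complex model $\mathrm{KC}_j^{(D,s)}(\mathbf f;\mathbb Z_N)$ is the CSS code with $\varphi_X=\partial_j^\dagger:K_{j-1}^\dagger\to K_j^\dagger$, $\varphi_Z=\partial_{j+1}:K_{j+1}\to K_j$. A CSS code is topological if $\operatorname{im}\varphi_X=\ker\varphi_Z^\dagger$ and $\operatorname{im}\varphi_Z=\ker\varphi_X^\dagger$. *)

(* Defs.v *)
From HB Require Import structures.
From mathcomp Require Import all_boot all_algebra finmap.
From mathcomp Require Import generic_quotient ring_quotient.
From mathcomp Require Import boolp functions.
From mathcomp Require Import monalg.

Set Implicit Arguments.
Unset Strict Implicit.
Unset Printing Implicit Defensive.

Import GRing.Theory.

Local Open Scope ring_scope.

(* The ring K[x_1^{+-1}, ..., x_D^{+-1}] = K[Z^D].  The ring instance that    *)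
(* monalg puts on {malg K[M]} excludes monoids M with nontrivial units, so    *)
(* the convolution product on Z^D is defined here.                            *)
Definition laurent (K : comNzRingType) (D : nat) : Type :=
  {malg K['rV[int]_D]}.

HB.instance Definition _ (K : comNzRingType) (D : nat) :=
  GRing.Zmodule.copy (laurent K D) {malg K['rV[int]_D]}.

(* Monomials c x^v, the convolution product, and the K-linear involution      *)
(* x^v |-> x^{-v}.                                                            *)
HB.lock Definition lmonom (K : comNzRingType) (D : nat) (v : 'rV[int]_D)
    (c : K) : laurent K D :=
  << c *g v >>.

HB.lock Definition lmul (K : comNzRingType) (D : nat) (g1 g2 : laurent K D) :
    laurent K D :=
  \sum_(u <- msupp g1) \sum_(v <- msupp g2) lmonom (u + v) (g1@_u * g2@_v).

HB.lock Definition lconj (K : comNzRingType) (D : nat) (g : laurent K D) :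
    laurent K D :=
  \sum_(v <- msupp g) lmonom (- v) g@_v.

Section Laurent.
Variables (K : comNzRingType) (D : nat).
Local Notation L := (laurent K D).
Local Notation lmonom := (@lmonom K D).
Local Notation lmul := (@lmul K D).
Local Notation lconj := (@lconj K D).
Implicit Types (g : L) (u v : 'rV[int]_D) (c : K).

Definition lone : L := lmonom 0 1.

Lemma mcoeff_lmonom v c u : (lmonom v c)@_u = c *+ (v == u).
Proof. by rewrite lmonom.unlock mcoeffU. Qed.

Let msupp_lmonom v c : (msupp (lmonom v c) `<=` [fset v])%fset.
Proof. by rewrite lmonom.unlock; exact: msuppU_le. Qed.

Let mcoeff_lmonomE v c : (lmonom v c)@_v = c.
Proof. by rewrite mcoeff_lmonom eqxx. Qed.

Fact lmonom_is_additive v : zmod_morphism (lmonom v).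
Proof. by rewrite lmonom.unlock => x y; rewrite monalgUB. Qed.
HB.instance Definition _ v :=
  GRing.isZmodMorphism.Build K L (lmonom v) (lmonom_is_additive v).

Lemma lmonom0 v : lmonom v 0 = 0.
Proof. exact: (raddf0 (lmonom v)). Qed.

Lemma lmonomD v : {morph lmonom v : a b / a + b}.
Proof. exact: (raddfD (lmonom v)). Qed.

Lemma laurentE g : g = \sum_(v <- msupp g) lmonom v g@_v.
Proof. by rewrite lmonom.unlock; exact: monalgE. Qed.

Let lmulw (d1 d2 : {fset 'rV[int]_D}) g1 g2 :
    (msupp g1 `<=` d1)%fset -> (msupp g2 `<=` d2)%fset ->
  lmul g1 g2 =
    \sum_(u <- d1) \sum_(v <- d2) lmonom (u + v) (g1@_u * g2@_v).
Proof.
move=> le1 le2; rewrite lmul.unlock (big_fset_incl _ le1) /=.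
  apply: eq_bigr => u _; apply: big_fset_incl => // v _ /mcoeff_outdom ->.
  by rewrite mulr0 lmonom0.
move=> u _ /mcoeff_outdom g1u.
by rewrite big1 // => v _; rewrite g1u mul0r lmonom0.
Qed.

Let lmul0g : left_zero 0 lmul.
Proof. by move=> g; rewrite lmul.unlock msupp0 big_seq_fset0. Qed.

Lemma lmonomM c1 c2 u v :
  lmul (lmonom u c1) (lmonom v c2) = lmonom (u + v) (c1 * c2).
Proof.
rewrite (lmulw (msupp_lmonom _ _) (msupp_lmonom _ _)) !big_seq_fset1.
by rewrite !mcoeff_lmonomE.
Qed.

Let lmulC : commutative lmul.
Proof.
move=> g1 g2; rewrite lmul.unlock exchange_big /=.
by apply: eq_bigr => u _; apply: eq_bigr => v _; rewrite mulrC addrC.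
Qed.

Let lmul1g : left_id lone lmul.
Proof.
move=> g; rewrite (lmulw (msupp_lmonom _ _) (fsubset_refl _)) big_seq_fset1.
rewrite [RHS]laurentE; apply: eq_bigr => v _.
by rewrite mcoeff_lmonomE mul1r add0r.
Qed.

Let lmulDl : left_distributive lmul +%R.
Proof.
move=> g1 g2 g.
rewrite (lmulw (msuppD_le g1 g2) (fsubset_refl (msupp g))).
rewrite (lmulw (fsubsetUl _ (msupp g2)) (fsubset_refl (msupp g))).
rewrite (lmulw (fsubsetUr (msupp g1) _) (fsubset_refl (msupp g))).
rewrite -big_split /=; apply: eq_bigr => u _.
rewrite -big_split /=; apply: eq_bigr => v _.
by rewrite mcoeffD mulrDl lmonomD.
Qed.

Let lmulDr : right_distributive lmul +%R.
Proof. by move=> g1 g2 g3; rewrite lmulC lmulDl !(lmulC g1). Qed.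

Let lmulg0 : right_zero 0 lmul.
Proof. by move=> g; rewrite lmulC lmul0g. Qed.

Let lmul_suml (I : Type) (r : seq I) (F : I -> L) g :
  lmul (\sum_(i <- r) F i) g = \sum_(i <- r) lmul (F i) g.
Proof. exact: (big_morph (lmul^~ g) (fun x y => lmulDl x y g) (lmul0g g)). Qed.

Let lmul_sumr (I : Type) (r : seq I) (F : I -> L) g :
  lmul g (\sum_(i <- r) F i) = \sum_(i <- r) lmul g (F i).
Proof. exact: (big_morph (lmul g) (lmulDr g) (lmulg0 g)). Qed.

Let lmulA : associative lmul.
Proof.
move=> g1 g2 g3.
rewrite (laurentE g1) !lmul_suml; apply: eq_bigr => u _.
rewrite (laurentE g2) lmul_suml !lmul_sumr lmul_suml; apply: eq_bigr => v _.
rewrite (laurentE g3) !lmul_sumr; apply: eq_bigr => w _.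
by rewrite !lmonomM mulrA addrA.
Qed.

Let lone_neq0 : lone != 0.
Proof.
apply/eqP => /malgP /(_ 0) /eqP.
by rewrite mcoeff_lmonomE mcoeff0 oner_eq0.
Qed.

HB.instance Definition _ := GRing.Zmodule_isComNzRing.Build L
  lmulA lmulC lmul1g lmulDl lone_neq0.

Lemma laurentM g1 g2 : g1 * g2 =
  \sum_(u <- msupp g1) \sum_(v <- msupp g2) lmonom (u + v) (g1@_u * g2@_v).
Proof. by rewrite -[LHS]/(lmul g1 g2) lmul.unlock. Qed.

Let lconjw (d : {fset 'rV[int]_D}) g : (msupp g `<=` d)%fset ->
  lconj g = \sum_(v <- d) lmonom (- v) g@_v.
Proof.
move=> le; rewrite lconj.unlock (big_fset_incl _ le) //=.
move=> v _ /mcoeff_outdom->.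
by rewrite lmonom0.
Qed.

Lemma lconj_monom c v : lconj (lmonom v c) = lmonom (- v) c.
Proof.
by rewrite (lconjw (msupp_lmonom _ _)) big_seq_fset1 mcoeff_lmonomE.
Qed.

Fact lconj_is_additive : zmod_morphism lconj.
Proof.
move=> g1 g2; pose d := (msupp g1 `|` msupp g2)%fset.
rewrite (@lconjw d) ?msuppB_le // (@lconjw d g1) ?fsubsetUl //.
rewrite (@lconjw d g2) ?fsubsetUr // -sumrB; apply: eq_bigr => v _.
by rewrite mcoeffB (raddfB (lmonom (- v))).
Qed.
HB.instance Definition _ :=
  GRing.isZmodMorphism.Build L L lconj lconj_is_additive.

Fact lconj_is_multiplicative : monoid_morphism lconj.
Proof.
split=> [|g1 g2]; first by rewrite lconj_monom oppr0.
rewrite laurentM raddf_sum /= (lconjw (fsubset_refl (msupp g1))) mulr_suml.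
apply: eq_bigr => u _.
rewrite raddf_sum (lconjw (fsubset_refl (msupp g2))) mulr_sumr.
apply: eq_bigr => v _ /=.
by rewrite lconj_monom opprD -lmonomM.
Qed.
HB.instance Definition _ :=
  GRing.isMonoidMorphism.Build L L lconj lconj_is_multiplicative.

Lemma lconjK : involutive lconj.
Proof.
move=> g; rewrite [in RHS](laurentE g) (lconjw (fsubset_refl (msupp g))).
by rewrite raddf_sum; apply: eq_bigr => v _ /=; rewrite lconj_monom opprK.
Qed.

(* The module bar M: a copy of the abelian group M, with scalars acting       *)
(* through lconj.                                                             *)
Record bar (M : lmodType L) : Type := Bar { unbar : M }.

Section Bar.
Variable M : lmodType L.
Implicit Types x y : bar M.

HB.instance Definition _ := [isNew for @unbar M].
HB.instance Definition _ := [Choice of bar M by <:].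

Definition bar_add x y := Bar (unbar x + unbar y).
Definition bar_opp x := Bar (- unbar x).
Definition bar_scale (r : L) x := Bar (lconj r *: unbar x).

Let bar_addA : associative bar_add.
Proof. by move=> x y z; apply: val_inj; rewrite /= addrA. Qed.

Let bar_addC : commutative bar_add.
Proof. by move=> x y; apply: val_inj; rewrite /= addrC. Qed.

Let bar_add0 : left_id (Bar 0) bar_add.
Proof. by move=> x; apply: val_inj; rewrite /= add0r. Qed.

Let bar_addN : left_inverse (Bar 0) bar_opp bar_add.
Proof. by move=> x; apply: val_inj; rewrite /= addNr. Qed.

HB.instance Definition _ := GRing.isZmodule.Build (bar M)
  bar_addA bar_addC bar_add0 bar_addN.

Let bar_scaleA a b x : bar_scale a (bar_scale b x) = bar_scale (a * b) x.
Proof. by apply: val_inj; rewrite /= scalerA rmorphM. Qed.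

Let bar_scale1 : left_id 1 bar_scale.
Proof. by move=> x; apply: val_inj; rewrite /= rmorph1 scale1r. Qed.

Let bar_scaleDr : right_distributive bar_scale +%R.
Proof. by move=> a x y; apply: val_inj; rewrite /= scalerDr. Qed.

Let bar_scaleDl x : {morph bar_scale^~ x : a b / a + b}.
Proof. by move=> a b; apply: val_inj; rewrite /= rmorphD scalerDl. Qed.

HB.instance Definition _ := GRing.Zmodule_isLmodule.Build L (bar M)
  bar_scaleA bar_scale1 bar_scaleDr bar_scaleDl.

Lemma unbarD x y : unbar (x + y) = unbar x + unbar y. Proof. by []. Qed.

Lemma unbarZ (r : L) x : unbar (r *: x) = lconj r *: unbar x. Proof. by []. Qed.
End Bar.

End Laurent.

Section Modules.
Variable R : comNzRingType.

Definition lmod_iso (U V : lmodType R) : Prop :=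
  exists f : {linear U -> V}, bijective f.

Definition is_zero_mod (U : lmodType R) : Prop := forall x : U, x = 0.

Section Submodule.
Variables (V : lmodType R) (P : submodClosed V).

Record submod : Type := Submod { submod_val : V; _ : submod_val \in P }.

HB.instance Definition _ := [isSub for submod_val].
HB.instance Definition _ := [Choice of submod by <:].
HB.instance Definition _ := [SubChoice_isSubLmodule of submod by <:].
End Submodule.

Section QuotientModule.
Variables (V : lmodType R) (P : submodClosed V).
Local Open Scope quotient_scope.

(* submodClosed does not inherit from zmodClosed, which {quot _} requires. *)
Definition quot_pred : {pred V} := fun v => v \in P.

Fact quot_pred_closed : zmod_closed quot_pred.
Proof.
split=> [|u v uP vP]; first exact: rpred0.
by rewrite -scaleN1r; apply: rpredD => //; apply: rpredZ.
Qed.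
HB.instance Definition _ :=
  GRing.isZmodClosed.Build V quot_pred quot_pred_closed.

Definition quotmod : Type := Quotient.quot quot_pred.

HB.instance Definition _ := GRing.Zmodule.on quotmod.

Definition quot_proj (v : V) : quotmod := \pi_(Quotient.quot quot_pred) v.

Definition quot_scale (a : R) (x : quotmod) : quotmod :=
  quot_proj (a *: repr (x : (Quotient.quot quot_pred))).

Fact quot_proj_is_additive : zmod_morphism quot_proj.
Proof. by move=> u v; rewrite /quot_proj raddfB. Qed.
HB.instance Definition _ :=
  GRing.isZmodMorphism.Build V quotmod quot_proj quot_proj_is_additive.

Lemma quot_proj_eq u v : (quot_proj u == quot_proj v) = (u - v \in P).
Proof. exact/esym/(Quotient.idealrBE quot_pred). Qed.

Lemma quot_projP (x : quotmod) : exists v, x = quot_proj v.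
Proof.
by exists (repr (x : Quotient.quot quot_pred)); rewrite /quot_proj reprK.
Qed.

Lemma quot_projZ a v : quot_proj (a *: v) = quot_scale a (quot_proj v).
Proof.
apply/eqP; rewrite quot_proj_eq -scalerBr rpredZ // -quot_proj_eq.
by rewrite {2}/quot_proj reprK.
Qed.

Let quot_scaleA a b x : quot_scale a (quot_scale b x) = quot_scale (a * b) x.
Proof. by have [v ->] := quot_projP x; rewrite -!quot_projZ scalerA. Qed.

Let quot_scale1 : left_id 1 quot_scale.
Proof.
by move=> x; have [v ->] := quot_projP x; rewrite -quot_projZ scale1r.
Qed.

Let quot_scaleDr : right_distributive quot_scale +%R.
Proof.
move=> a x y; have [u ->] := quot_projP x; have [v ->] := quot_projP y.
by rewrite -raddfD -!quot_projZ -raddfD scalerDr.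
Qed.

Let quot_scaleDl x : {morph quot_scale^~ x : a b / a + b}.
Proof.
move=> a b; have [v ->] := quot_projP x.
by rewrite -!quot_projZ -raddfD scalerDl.
Qed.

HB.instance Definition _ := GRing.Zmodule_isLmodule.Build R quotmod
  quot_scaleA quot_scale1 quot_scaleDr quot_scaleDl.

HB.instance Definition _ :=
  GRing.isScalable.Build R V quotmod *:%R quot_proj quot_projZ.
End QuotientModule.

Definition ker_pred (U V : lmodType R) (f : {linear U -> V}) : {pred U} :=
  [pred u | f u == 0].

Section Kernel.
Variables (U V : lmodType R) (f : {linear U -> V}).

Fact ker_pred_closed : submod_closed (ker_pred f).
Proof.
split=> [|a u v]; rewrite !inE ?linear0 // linearP => /eqP-> /eqP->.
by rewrite scaler0 addr0.
Qed.
HB.instance Definition _ :=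
  GRing.isSubmodClosed.Build R U (ker_pred f) ker_pred_closed.

Definition ker : lmodType R := submod (ker_pred f).
End Kernel.

(* The homology of U -f-> V -g-> W.  The relation g \o f = 0 is not needed:   *)
(* ker g is divided by its intersection with im f.                            *)
Definition bnd_pred (U V W : lmodType R) (f : {linear U -> V})
    (g : {linear V -> W}) : {pred ker g} :=
  [pred x | `[< exists u, val x = f u >]].
Arguments bnd_pred {U V W} f g _ /.

Section Homology.
Variables (U V W : lmodType R) (f : {linear U -> V}) (g : {linear V -> W}).

Fact bnd_pred_closed : submod_closed (bnd_pred f g).
Proof.
split=> [|a x y]; rewrite !inE.
  by apply/asboolP; exists 0; rewrite !raddf0.
move=> /asboolP[u xu] /asboolP[v yv]; apply/asboolP; exists (a *: u + v).
by rewrite !linearP /= -xu -yv.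
Qed.
HB.instance Definition _ :=
  GRing.isSubmodClosed.Build R (ker g) (bnd_pred f g) bnd_pred_closed.

Definition homology : lmodType R := quotmod (bnd_pred f g).
End Homology.

Definition linear_pred (U V : lmodType R) : {pred U -> V} :=
  [pred h | `[< linear h >]].

Section Hom.
Variables (U V : lmodType R).

Fact linear_pred_closed : submod_closed (@linear_pred U V).
Proof.
split=> [|a h k]; rewrite !inE.
  by apply/asboolP => b u v; rewrite scaler0 addr0.
move=> /asboolP hl /asboolP kl; apply/asboolP => b u v.
rewrite -[LHS]/(a *: h (b *: u + v) + k (b *: u + v)) hl kl.
rewrite -[X in _ = _ *: X + _]/(a *: h u + k u).
rewrite -[X in _ = _ + X]/(a *: h v + k v).
by rewrite !scalerDr !scalerA (mulrC a b) addrACA.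
Qed.
HB.instance Definition _ := GRing.isSubmodClosed.Build R (U -> V)
  (@linear_pred U V) linear_pred_closed.

Definition Hom : lmodType R := submod (@linear_pred U V).

Definition hom_fun (h : Hom) : U -> V := val h.

Fact hom_fun_is_linear h : linear (hom_fun h).
Proof. by have /asboolP := valP h. Qed.
HB.instance Definition _ h :=
  GRing.isLinear.Build R U V *:%R (hom_fun h) (hom_fun_is_linear h).

Lemma linear_in_pred (h : {linear U -> V}) : (h : U -> V) \in @linear_pred U V.
Proof. by rewrite inE; apply/asboolP => a u v; exact: linearP. Qed.

Definition hom_of (h : {linear U -> V}) : Hom :=
  Sub (h : U -> V) (linear_in_pred h).

Lemma homP (h k : Hom) : hom_fun h =1 hom_fun k -> h = k.
Proof. by move=> hk; apply: val_inj; apply/funext. Qed.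

Lemma hom_funD (h k : Hom) u : hom_fun (h + k) u = hom_fun h u + hom_fun k u.
Proof. by []. Qed.

Lemma hom_funZ a (h : Hom) u : hom_fun (a *: h) u = a *: hom_fun h u.
Proof. by []. Qed.
End Hom.


(* Hom(f, N) : Hom(V, N) -> Hom(U, N),  h |-> h \o f. *)
Section Precomposition.
Variables (U V N : lmodType R) (f : {linear U -> V}).

Definition precomp (h : Hom V N) : Hom U N := hom_of (hom_fun h \o f).

Fact precomp_is_linear : linear precomp.
Proof. by move=> a h k; exact: homP. Qed.
HB.instance Definition _ :=
  GRing.isLinear.Build R (Hom V N) (Hom U N) *:%R precomp precomp_is_linear.
End Precomposition.
Arguments precomp {U V} N f h.

(* The free module {malg R[M]} on the underlying set of M and its canonical   *)
(* surjection onto M.                                                         *)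
Section FreeCover.
Variable M : lmodType R.

Definition free_eval (g : {malg R[M]}) : M := \sum_(m <- msupp g) g@_m *: m.

Lemma free_evalw (d : {fset M}) g : (msupp g `<=` d)%fset ->
  free_eval g = \sum_(m <- d) g@_m *: m.
Proof.
move=> le; rewrite /free_eval (big_fset_incl _ le) //= => m _ /mcoeff_outdom ->.
by rewrite scale0r.
Qed.

Fact free_eval_is_linear : linear free_eval.
Proof.
move=> a g h; pose d := (msupp g `|` msupp h)%fset.
have gd : (msupp g `<=` d)%fset by rewrite fsubsetUl.
have hd : (msupp h `<=` d)%fset by rewrite fsubsetUr.
have agd : (msupp (a *: g) `<=` d)%fset.
  by apply: fsubset_trans gd; apply: msuppZ_le.
rewrite (free_evalw gd) (free_evalw hd) (@free_evalw d); last first.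
  by apply: fsubset_trans (msuppD_le _ _) _; rewrite fsubUset agd.
rewrite scaler_sumr -big_split /=; apply: eq_bigr => m _.
by rewrite mcoeffD mcoeffZ scalerDl scalerA.
Qed.
HB.instance Definition _ :=
  GRing.isLinear.Build R {malg R[M]} M *:%R free_eval free_eval_is_linear.

Lemma free_evalU c m : free_eval << c *g m >> = c *: m.
Proof. by rewrite (free_evalw msuppU_le) big_seq_fset1 mcoeffUU. Qed.
End FreeCover.

(* The standard free resolution ... -> F 1 -> F 0 -> M, where F n is the free *)
(* module on the n-th syzygy module: syzygy M 0 = M and syzygy M n.+1 is the  *)
(* kernel of F n -> syzygy M n.                                               *)
Fixpoint syzygy (M : lmodType R) (n : nat) : lmodType R :=
  if n is n'.+1 then ker (@free_eval (syzygy M n')) else M.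

Section StandardResolution.
Variable M : lmodType R.

Definition std_res (n : nat) : lmodType R := {malg R[syzygy M n]}.

Definition std_diff n (g : std_res n.+1) : std_res n :=
  val (free_eval g : ker (@free_eval (syzygy M n))).

Fact std_diff_is_linear n : linear (@std_diff n).
Proof. by move=> a g h; rewrite /std_diff !linearP. Qed.
HB.instance Definition _ n := GRing.isLinear.Build R (std_res n.+1) (std_res n)
  *:%R (@std_diff n) (@std_diff_is_linear n).

Lemma std_res_aug_surj (m : M) : exists g : std_res 0, free_eval g = m.
Proof. by exists << 1 *g m >>; rewrite free_evalU scale1r. Qed.

Let std_diffU n (k : syzygy M n.+1) : std_diff << 1 *g k >> = val k.
Proof. exact: (congr1 val (etrans (free_evalU 1 k) (scale1r k))). Qed.

Let free_eval_val n (k : syzygy M n.+1) :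
  free_eval (val k : {malg R[syzygy M n]}) = 0.
Proof. by apply/eqP; exact: valP k. Qed.

Lemma std_res_exact0 (g : std_res 0) :
  free_eval g = 0 <-> exists h, g = @std_diff 0 h.
Proof.
split=> [g0|[h ->]]; last exact: free_eval_val.
have gk : g \in ker_pred (@free_eval M) by rewrite inE; apply/eqP.
by exists << 1 *g (Sub g gk : syzygy M 1) >>; rewrite std_diffU.
Qed.

Lemma std_res_exact n (g : std_res n.+1) :
  std_diff g = 0 <-> exists h, g = @std_diff n.+1 h.
Proof.
split=> [g0|[h ->]]; last exact: (congr1 val (free_eval_val (free_eval h))).
have gk : g \in ker_pred (@free_eval (syzygy M n.+1)).
  by rewrite inE; apply/eqP/val_inj.
by exists << 1 *g (Sub g gk : syzygy M n.+2) >>; rewrite std_diffU.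
Qed.
End StandardResolution.

Definition Ext_diff (M N : lmodType R) (n : nat) :
    {linear Hom (std_res M n) N -> Hom (std_res M n.+1) N} :=
  precomp N (@std_diff M n).

Definition Ext (n : nat) (M N : lmodType R) : lmodType R :=
  if n is n'.+1 then homology (Ext_diff M N n') (Ext_diff M N n'.+1)
  else ker (Ext_diff M N 0).

Definition ideal_gen (rs : seq R) : {pred R^o} :=
  [pred r | `[< exists c : 'I_(size rs) -> R, r = \sum_i c i * rs`_i >]].

Fact ideal_gen_closed rs : submod_closed (ideal_gen rs).
Proof.
split=> [|a r1 r2]; rewrite !inE.
  by apply/asboolP; exists (fun=> 0); rewrite big1 // => i _; rewrite mul0r.
move=> /asboolP[c ->] /asboolP[d ->]; apply/asboolP.
exists (fun i => a * c i + d i).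
rewrite [_ *: _]mulr_sumr -big_split /=; apply: eq_bigr => i _.
by rewrite mulrDl mulrA.
Qed.
HB.instance Definition _ rs :=
  GRing.isSubmodClosed.Build R R^o (ideal_gen rs) (ideal_gen_closed rs).

Definition cyclic_mod (rs : seq R) : lmodType R := quotmod (ideal_gen rs).

Definition nonzerodivisor_on (M : lmodType R) (r : R) : Prop :=
  forall m : M, r *: m = 0 -> m = 0.

(* For i = 0 the module is R / (0). *)
Definition regular_sequence (s : nat) (f : s.-tuple R) : Prop :=
  forall i : 'I_s, nonzerodivisor_on (cyclic_mod (take i f)) (tnth f i).

Section MatrixModules.
Variables (m n : nat) (phi : 'M[R]_(m, n)).

Definition im_mx : {pred 'cV[R]_m} :=
  [pred v | `[< exists u : 'cV[R]_n, v = phi *m u >]].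

Definition ker_mx : {pred 'cV[R]_n} := [pred u | phi *m u == 0].

Fact im_mx_closed : submod_closed im_mx.
Proof.
split=> [|a v w]; rewrite !inE.
  by apply/asboolP; exists 0; rewrite mulmx0.
move=> /asboolP[u ->] /asboolP[t ->]; apply/asboolP; exists (a *: u + t).
by rewrite mulmxDr scalemxAr.
Qed.
HB.instance Definition _ :=
  GRing.isSubmodClosed.Build R 'cV[R]_m im_mx im_mx_closed.

Definition coker_mx : lmodType R := quotmod im_mx.
End MatrixModules.

(* The Koszul complex.  The i-th exterior power of R^s is the free module on  *)
(* the i-subsets {a_1 < ... < a_i} of 'I_s, standing for the basis vectors    *)
(* e_{a_1} /\ ... /\ e_{a_i}.                                                 *)
Section Koszul.
Variables (s : nat) (f : s.-tuple R).

Definition isubsets (i : nat) : {set {set 'I_s}} :=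
  [set A : {set 'I_s} | #|A| == i].

Definition koszul_rank (i : nat) : nat := #|isubsets i|.

(* For x = a_k in A = {a_1 < ... < a_i}, the cardinal below is k - 1. *)
Definition koszul_coef (B A : {set 'I_s}) : R :=
  \sum_(x in A | A :\ x == B) (-1) ^+ #|[set y in A | (y < x)%N]| * tnth f x.

(* The boundary K_i -> K_(i-1); for i = 0 it is the zero map of K_0. *)
Definition koszul_d (i : nat) : 'M[R]_(koszul_rank i.-1, koszul_rank i) :=
  \matrix_(b, a) koszul_coef (enum_val b) (enum_val a).

Let cntD1 (A : {set 'I_s}) x y : x \in A ->
  #|[set z in A | (z < y)%N]| =
    ((x < y)%N + #|[set z in A :\ x | (z < y)%N]|)%N.
Proof.
move=> xA; rewrite (cardsD1 x) !inE xA /=; congr (_ + _)%N.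
by apply: eq_card => z; rewrite !inE andbA.
Qed.

Lemma koszul_dd i : koszul_d i *m koszul_d i.+1 = 0.
Proof.
apply/matrixP => c a; rewrite !mxE /=.
set C := enum_val c; set A := enum_val a.
have cardA : #|A| = i.+1 by have := enum_valP a; rewrite inE => /eqP.
transitivity (\sum_(B in isubsets i) koszul_coef C B * koszul_coef B A).
  by rewrite [RHS]big_enum_val; apply: eq_bigr => b _; rewrite !mxE.
pose t (x y : 'I_s) : R := (-1) ^+ #|[set z in A :\ x | (z < y)%N]| *
  (-1) ^+ #|[set z in A | (z < x)%N]| * (tnth f x * tnth f y).
pose P (x y : 'I_s) := [&& x \in A, y \in A, x != y & A :\ x :\ y == C].
have tN (x y : 'I_s) : P x y -> (x < y)%N -> t x y = - t y x.
  move=> /and4P[xA yA nxy _] xy; rewrite /t (cntD1 y xA) xy (cntD1 x yA).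
  rewrite ltnNge (ltnW xy) /= add0n add1n exprS mulN1r mulrN mulNr opprK.
  by rewrite (mulrC (tnth f x)); congr (_ * _); rewrite mulrC.
transitivity (\sum_x \sum_(y | P x y) t x y); last first.
  rewrite pair_big_dep /= (bigID (fun p : 'I_s * 'I_s => p.1 < p.2)%N) /=.
  rewrite [X in _ + X](reindex_inj (h := fun p : 'I_s * 'I_s => (p.2, p.1))) /=;
    last by move=> [x y] [x' y'] [-> ->].
  have PC (x y : 'I_s) : P y x = P x y.
    by rewrite /P !setDDl setUC eq_sym andbCA.
  have ltC (x y : 'I_s) : P x y && ~~ (y < x)%N = P x y && (x < y)%N.
    have [/and4P[_ _ nxy _]|//] := boolP (P x y); rewrite /= -leqNgt ltn_neqAle.
    by rewrite -[(x != y :> nat)]/(x != y) nxy.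
  under [X in _ + X]eq_bigl do rewrite PC ltC.
  by rewrite -big_split big1 // => -[x y] /= /andP[Pxy xy]; rewrite tN // addNr.
under eq_bigr => B _ do rewrite mulr_sumr big_mkcond /=.
rewrite exchange_big /=; apply: eq_bigr => x _.
have [xA|xA] := boolP (x \in A); last first.
  by rewrite big1 ?big1 // => y; rewrite /P (negPf xA).
have cardAx : A :\ x \in isubsets i.
  by rewrite inE; move: cardA; rewrite (cardsD1 x) xA add1n => -[->].
rewrite (bigD1 (A :\ x)) //= eqxx big1 ?addr0; last first.
  by move=> B /andP[_ /negPf nB]; rewrite eq_sym nB.
rewrite /koszul_coef mulr_suml; apply: eq_big => y.
  by rewrite /P !inE xA eq_sym; case: (y \in A); case: (x != y).
by move=> _; rewrite /t mulrACA [tnth f y * _]mulrC.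
Qed.
End Koszul.

End Modules.

Arguments bnd_pred {R U V W} f g _ /.
Arguments precomp {R U V} N f h.

Section CSS.
Variables (K : comNzRingType) (D : nat).
Local Notation L := (laurent K D).

Definition dual (M : lmodType L) : lmodType L := Hom (bar M) L^o.

Definition bar_map (U V : lmodType L) (h : {linear U -> V}) (x : bar U) :
  bar V := Bar (h (unbar x)).

Fact bar_map_is_linear (U V : lmodType L) (h : {linear U -> V}) :
  linear (bar_map h).
Proof.
by move=> a x y; apply: val_inj; rewrite /= linearP.
Qed.
HB.instance Definition _ (U V : lmodType L) (h : {linear U -> V}) :=
  GRing.isLinear.Build L (bar U) (bar V) *:%R (bar_map h) (bar_map_is_linear h).

(* phi^dagger as a matrix: dual_vec identifies L^n with the dual of L^n, and  *)
(* dual_vec_dagger shows that dagger phi is then precomposition with phi.     *)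
Definition dagger (m n : nat) (phi : 'M[L]_(m, n)) : 'M[L]_(n, m) :=
  (map_mx (@lconj K D) phi)^T.

Section DualVector.
Variable n : nat.

Definition dual_fun (v : 'cV[L]_n) (u : bar 'cV[L]_n) : L^o :=
  \sum_i v i 0 * lconj (unbar u i 0).

Fact dual_fun_is_linear v : linear (dual_fun v).
Proof.
move=> a x y; rewrite [_ *: dual_fun _ _]mulr_sumr -big_split /=.
apply: eq_bigr => i _; rewrite unbarD unbarZ !mxE.
by rewrite rmorphD rmorphM /= lconjK mulrDr mulrCA.
Qed.
HB.instance Definition _ v := GRing.isLinear.Build L (bar 'cV[L]_n) L^o *:%R
  (dual_fun v) (dual_fun_is_linear v).

Definition dual_vec (v : 'cV[L]_n) : dual 'cV[L]_n := hom_of (dual_fun v).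

Fact dual_vec_is_linear : linear dual_vec.
Proof.
move=> a v w; apply: homP => u; rewrite hom_funD hom_funZ.
rewrite -[LHS]/(dual_fun (a *: v + w) u).
rewrite -[RHS]/(a * dual_fun v u + dual_fun w u).
rewrite mulr_sumr -big_split /=; apply: eq_bigr => i _.
by rewrite !mxE mulrDl mulrA.
Qed.
HB.instance Definition _ := GRing.isLinear.Build L 'cV[L]_n (dual 'cV[L]_n)
  *:%R dual_vec dual_vec_is_linear.

Lemma dual_vec_bij : bijective dual_vec.
Proof.
exists (fun h : dual 'cV[L]_n => \col_i hom_fun h (Bar (delta_mx i 0))).
  move=> v; apply/colP => i; rewrite mxE -[LHS]/(dual_fun v _) /dual_fun.
  rewrite (bigD1 i) //= big1 ?addr0.
    by rewrite mxE !eqxx rmorph1 mulr1.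
  by move=> k /negPf ki; rewrite mxE ki rmorph0 mulr0.
move=> h; apply: homP => -[u]; rewrite -[LHS]/(dual_fun _ (Bar u)) /dual_fun.
have uE : Bar u = \sum_i lconj (u i 0) *: Bar (delta_mx i 0).
  have unbar_sum (I : Type) (r : seq I) (F : I -> bar 'cV[L]_n) :
      unbar (\sum_(i <- r) F i) = \sum_(i <- r) unbar (F i).
    exact: (big_morph (@unbar _ _ 'cV[L]_n) (@unbarD _ _ _) erefl).
  apply: val_inj; rewrite /= unbar_sum [LHS]matrix_sum_delta.
  by apply: eq_bigr => i _; rewrite big_ord1 unbarZ lconjK.
rewrite [in RHS]uE linear_sum; apply: eq_bigr => i _.
by rewrite linearZ mxE; exact: mulrC.
Qed.
End DualVector.

Lemma dual_vec_dagger m n (phi : 'M[L]_(m, n)) (w : 'cV[L]_m) :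
  dual_vec (dagger phi *m w) =
    precomp L^o (bar_map (mulmx phi : {linear 'cV[L]_n -> 'cV[L]_m}))
      (dual_vec w).
Proof.
apply: homP => u; rewrite -[LHS]/(dual_fun _ u).
rewrite -[RHS]/(dual_fun w (Bar (phi *m unbar u))) /dual_fun.
under eq_bigr => i _ do rewrite mxE mulr_suml.
under [RHS]eq_bigr => i _ do rewrite mxE rmorph_sum mulr_sumr.
rewrite exchange_big /=; apply: eq_bigr => i _; apply: eq_bigr => k _.
by rewrite !mxE rmorphM [lconj _ * w _ _]mulrC mulrA.
Qed.

Record css_code := CSSCode {
  css_qubits : nat;
  css_nX : nat;
  css_nZ : nat;
  phiX : 'M[L]_(css_qubits, css_nX);
  phiZ : 'M[L]_(css_qubits, css_nZ);
  css_commute : dagger phiX *m phiZ = 0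
}.

Definition topological (C : css_code) : Prop :=
  im_mx (phiX C) =i ker_mx (dagger (phiZ C)) /\
  im_mx (phiZ C) =i ker_mx (dagger (phiX C)).

Lemma daggerK m n (phi : 'M[L]_(m, n)) : dagger (dagger phi) = phi.
Proof. by apply/matrixP => i j; rewrite !mxE lconjK. Qed.

Fact koszul_code_subproof s (f : s.-tuple L) j :
  dagger (dagger (koszul_d f j)) *m koszul_d f j.+1 = 0.
Proof. by rewrite daggerK koszul_dd. Qed.

Definition koszul_code s (f : s.-tuple L) (j : nat) : css_code :=
  CSSCode (koszul_code_subproof f j).
End CSS.

(* Main.v *)
(* Ext is computed from any exact sequence of matrices A_0, A_1, ... without  *)
(* chain maps. Call X and Y stably isomorphic if there are maps f, g between  *)
(* them with g f - 1 and f g - 1 factoring through projectives. If P -> X and *)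
(* Q -> Y are surjections from projectives, their kernels are again stably    *)
(* isomorphic, so every syzygy of the standard resolution of coker A_0 is     *)
(* stably isomorphic to coker A_n. Moreover Hom(ker, N) modulo restrictions   *)
(* from P only depends on X up to stable isomorphism.                         *)
(*                                                                            *)
(* The Koszul complex of a regular sequence is exact in positive degrees:     *)
(* that of f_1, ..., f_(n+1) is the mapping cone of f_(n+1) on that of        *)
(* f_1, ..., f_n. Complementation of subsets, with signs, identifies the      *)
(* transposed complex with the complex itself. Hence bar (coker phi_X) and    *)
(* bar (coker phi_Z) are, for f and for its conjugate respectively, of the    *)
(* form coker d_(m+1), with resolution 0 -> K_s -> ... -> K_(m+1) -> K_m.     *)

From HB Require Import structures.
From mathcomp Require Import all_boot all_algebra finmap.
From mathcomp Require Import boolp functions.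
From mathcomp Require Import monalg zify.
Require Import Defs.

Set Implicit Arguments.
Unset Strict Implicit.
Unset Printing Implicit Defensive.

Import GRing.Theory.
Local Open Scope ring_scope.

(** Write $d_i$ for the Koszul differentials of $f$. The two equalities in [topological] are
    exactness at $K_j$ of the Koszul complex of $f$ ([koszul_exact]) and of the transposed Koszul
    complex of the conjugate sequence ([koszul_trmx_exact]), which is again regular. The second
    reduces to the first by the self-duality of the Koszul complex.

    For Ext, [Ext_cover] identifies $\mathrm{Ext}^{n+1}(M,N)$ with $\mathrm{Hom}(Z,N)$ modulo
    restrictions from $P$, for any exact $0\to Z\to P\to X\to 0$ with $P$ projective and $X$ stably
    isomorphic to the $n$-th syzygy of $M$. Hence ([Ext_mx_resolution], [Ext_koszul])
    $\mathrm{Ext}^l(\mathrm{coker}\,d_{k+1},R)$ is, for $l>0$, the homology of the transposed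
    complex at $K_{k+l}$. It vanishes except at $K_s$, where it is
    $\mathrm{coker}\,d_s^T\cong\mathrm{coker}\,d_1\cong S$; so it is concentrated in $l=s-k$. The
    module [bar (coker phi_X)] is the case $k=s-j$ for $f$, and [bar (coker phi_Z)] is the case
    $k=j$ for the conjugate of $f$, whence $\overline S$ in place of $S$. *)

Section LinearAlgebra.
Variable R : comNzRingType.
Implicit Types U V W : lmodType R.

(** * Linear maps, isomorphisms and quotients *)

Lemma linear_bundle U V (h : U -> V) :
  linear h -> exists H : {linear U -> V}, H =1 h.
Proof.
move=> hl; pose hL := GRing.isLinear.Build R U V *:%R h hl.
by exists (HB.pack_for {linear U -> V} h hL).
Qed.

Lemma lmod_iso_inv U V : lmod_iso U V ->
  exists (f : {linear U -> V}) (g : {linear V -> U}), cancel f g /\ cancel g f.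
Proof.
case=> f [g fK gK].
have [g' g'E] : exists g' : {linear V -> U}, g' =1 g.
  by apply: linear_bundle => a x y; apply: (can_inj fK); rewrite gK linearP !gK.
by exists f, g'; split=> x; rewrite !g'E.
Qed.

Lemma lmod_iso_sym U V : lmod_iso U V -> lmod_iso V U.
Proof. by move=> /lmod_iso_inv[f [g [fK gK]]]; exists g; exists f. Qed.

Lemma lmod_iso_trans V U W : lmod_iso U V -> lmod_iso V W -> lmod_iso U W.
Proof. by move=> [f fB] [g gB]; exists (g \o f); apply: bij_comp. Qed.

Lemma is_zero_mod_iso U V : lmod_iso U V -> is_zero_mod V -> is_zero_mod U.
Proof.
move=> [f /bij_inj f_inj] V0 x; apply: f_inj.
by rewrite (V0 (f x)) (V0 (f 0)).
Qed.

Lemma bijective_linear U V (f : {linear U -> V}) :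
  (forall x, f x = 0 -> x = 0) -> (forall y, exists x, f x = y) -> lmod_iso U V.
Proof.
move=> f0 fs; have [g gK] := choice fs.
have f_inj : injective f.
  move=> x y fxy; apply/eqP; rewrite -subr_eq0; apply/eqP/f0.
  by rewrite linearB fxy subrr.
by exists f; exists g => // x; apply: f_inj; rewrite gK.
Qed.

Lemma quot_proj_eq0 V (P : submodClosed V) (v : V) :
  (quot_proj P v == 0) = (v \in P).
Proof. by rewrite -(raddf0 (quot_proj P)) quot_proj_eq subr0. Qed.

Lemma quotmod_lift V (P : submodClosed V) W (f : {linear V -> W}) :
  (forall v, v \in P -> f v = 0) ->
  exists g : {linear quotmod P -> W}, forall v, g (quot_proj P v) = f v.
Proof.
move=> fP.
have [h hE] := choice (@quot_projP _ V P).
have fh v : f (h (quot_proj P v)) = f v.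
  apply/eqP; rewrite -subr_eq0 -linearB fP // -quot_proj_eq; apply/eqP.
  by rewrite -hE.
have [|g gE] := @linear_bundle (quotmod P) W (f \o h); last first.
  by exists g => v; rewrite gE /= fh.
move=> a x y; rewrite /= [in LHS](hE x) [in LHS](hE y) -linearP fh.
by rewrite linearP.
Qed.

Lemma quotmod_iso U V (P : submodClosed U) (Q : submodClosed V)
    (f : {linear U -> V}) :
  (forall u, (f u \in Q) = (u \in P)) ->
  (forall v, exists u, f u - v \in Q) -> lmod_iso (quotmod P) (quotmod Q).
Proof.
move=> fPQ fs.
have [|g gE] := @quotmod_lift U P _ (quot_proj Q \o f).
  by move=> u uP /=; apply/eqP; rewrite quot_proj_eq0 fPQ.
apply: (@bijective_linear _ _ g) => [x|y].
  have [u ->] := quot_projP x; rewrite gE /= => /eqP.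
  by rewrite quot_proj_eq0 fPQ -quot_proj_eq0 => /eqP.
have [v ->] := quot_projP y; have [u fuv] := fs v.
by exists (quot_proj P u); rewrite gE /=; apply/eqP; rewrite quot_proj_eq.
Qed.

Lemma linear_factor U V W (i : {linear V -> W}) (h : {linear U -> W}) :
  injective i -> (forall u, exists v, h u = i v) ->
  exists g : {linear U -> V}, forall u, i (g u) = h u.
Proof.
move=> i_inj hi; have [g gE] := choice hi.
have [|G GE] := @linear_bundle U V g; last by exists G => u; rewrite GE gE.
by move=> a x y; apply: i_inj; rewrite linearP -!gE linearP.
Qed.

(** * Projective modules and stable isomorphism *)

Definition projective (P : lmodType R) : Prop :=
  forall U V (p : {linear U -> V}) (f : {linear P -> V}),
    (forall v, exists u, p u = v) ->
    exists g : {linear P -> U}, forall x, p (g x) = f x.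

Lemma projective_cV n : projective 'cV[R]_n.
Proof.
move=> U V p f ps; have [q qK] := choice ps.
pose h (x : 'cV[R]_n) := \sum_i x i 0 *: q (f (delta_mx i 0)).
have [|g gE] := @linear_bundle _ _ h; last first.
  exists g => x; rewrite gE linear_sum [in RHS](matrix_sum_delta x) linear_sum.
  by apply: eq_bigr => i _; rewrite big_ord1 !linearZ /= qK.
move=> a x y; rewrite /h scaler_sumr -big_split; apply: eq_bigr => i _ /=.
by rewrite !mxE scalerDl scalerA.
Qed.

Lemma projective_malg (T : choiceType) : projective {malg R[T]}.
Proof.
move=> U V p f ps; have [q qK] := choice ps.
pose h (x : {malg R[T]}) := \sum_(t <- msupp x) x@_t *: q (f << t >>).
have hw (d : {fset T}) x : (msupp x `<=` d)%fset ->
    h x = \sum_(t <- d) x@_t *: q (f << t >>).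
  move=> le; rewrite /h (big_fset_incl _ le) //= => t _ /mcoeff_outdom ->.
  by rewrite scale0r.
have [|g gE] := @linear_bundle _ _ h; last first.
  exists g => x; rewrite gE linear_sum [in RHS](monalgE x) linear_sum.
  apply: eq_bigr => t _; rewrite linearZ /= qK -linearZ /=; congr (f _).
  by apply/malgP => u; rewrite mcoeffZ !mcoeffU mulr_natr.
move=> a x y; pose d := (msupp x `|` msupp y)%fset.
rewrite (hw d x) ?fsubsetUl // (hw d y) ?fsubsetUr // (hw d); last first.
  apply: fsubset_trans (msuppD_le _ _) _; rewrite fsubUset fsubsetUr andbT.
  exact: fsubset_trans (msuppZ_le _ _) (fsubsetUl _ _).
rewrite scaler_sumr -big_split; apply: eq_bigr => t _ /=.
by rewrite mcoeffD mcoeffZ scalerDl scalerA.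
Qed.

(** Equality of [e] with the identity in the stable module category, where maps that factor through
    projectives are zero. *)
Definition stably_id U (e : U -> U) : Prop :=
  exists (P : lmodType R) (a : {linear U -> P}) (b : {linear P -> U}),
    projective P /\ forall u, e u - u = b (a u).

Definition stably_iso U V : Prop :=
  exists (f : {linear U -> V}) (g : {linear V -> U}),
    stably_id (g \o f) /\ stably_id (f \o g).

Lemma lmod_iso_stably U V : lmod_iso U V -> stably_iso U V.
Proof.
move=> /lmod_iso_inv[f [g [fK gK]]]; exists f, g.
by split; exists 'cV[R]_0, \0, \0; split=> [|u];
  rewrite /= ?fK ?gK ?subrr //; apply: projective_cV.
Qed.

(** A short exact sequence $0\to Z\to P\to X\to 0$ with $P$ projective. *)
Record projective_presentation (Z P X : lmodType R)
    (i : {linear Z -> P}) (p : {linear P -> X}) : Prop :=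
    ProjectivePresentation {
  pc_proj : projective P;
  pc_inj : injective i;
  pc_surj : forall x, exists y, p y = x;
  pc_exact : forall y, p y = 0 <-> exists z, y = i z }.

Section Cover.
Variables (Z P X Z' P' X' : lmodType R).
Variables (i : {linear Z -> P}) (p : {linear P -> X}).
Variables (i' : {linear Z' -> P'}) (p' : {linear P' -> X'}).
Hypothesis (cov : projective_presentation i p).
Hypothesis (cov' : projective_presentation i' p').

Lemma cover_lift (f : {linear X -> X'}) :
  exists (fP : {linear P -> P'}) (fZ : {linear Z -> Z'}),
    (forall y, p' (fP y) = f (p y)) /\ (forall z, i' (fZ z) = fP (i z)).
Proof.
have [fP fPE] := pc_proj cov (f \o p) (pc_surj cov').
have [|fZ fZE] := @linear_factor _ _ _ i' (fP \o i) (pc_inj cov').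
  move=> z; apply/(pc_exact cov'); rewrite /= fPE /=.
  have /(pc_exact cov) -> : exists z', i z = i z' by exists z.
  by rewrite linear0.
by exists fP, fZ; split.
Qed.

(* With g \o f - 1 = b \o a, lift b to b' into P; then gP \o fP - 1 - b' \o a *)
(* \o p takes values in ker p = Z and restricts to gZ \o fZ - 1 on Z.         *)
Lemma cover_homotopy (f : {linear X -> X'}) (g : {linear X' -> X})
    (fP : {linear P -> P'}) (fZ : {linear Z -> Z'})
    (gP : {linear P' -> P}) (gZ : {linear Z' -> Z}) :
  (forall y, p' (fP y) = f (p y)) -> (forall z, i' (fZ z) = fP (i z)) ->
  (forall y, p (gP y) = g (p' y)) -> (forall z, i (gZ z) = gP (i' z)) ->
  stably_id (g \o f) ->
  exists t : {linear P -> Z}, forall z, gZ (fZ z) - z = t (i z).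
Proof.
move=> fPE fZE gPE gZE [Q [a [b [Qp abE]]]].
have [b' b'E] := Qp _ _ p b (pc_surj cov).
have [|t tE] := @linear_factor _ _ _ i
    ((gP \o fP) \- idfun \- (b' \o (a \o p)))  (pc_inj cov).
  move=> y; apply/(pc_exact cov).
  by rewrite /= !linearB /= gPE fPE b'E -abE /= subrr.
exists t => z; apply: (pc_inj cov); rewrite tE linearB /= gZE fZE.
have /(pc_exact cov) -> : exists z', i z = i z' by exists z.
by rewrite !linear0 addr0.
Qed.
End Cover.

(** More precise than a stable isomorphism of [Z] and [Z']: the maps extend to [P] and [P'], and the
    homotopies are defined there. [Ext_cover] needs this, since it works modulo maps that extend to
    [P]. *)
Lemma cover_stably_iso (Z P X Z' P' X' : lmodType R)
    (i : {linear Z -> P}) (p : {linear P -> X})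
    (i' : {linear Z' -> P'}) (p' : {linear P' -> X'}) :
  projective_presentation i p -> projective_presentation i' p' ->
  stably_iso X X' ->
  exists (f : {linear Z -> Z'}) (g : {linear Z' -> Z})
      (fP : {linear P -> P'}) (gP : {linear P' -> P})
      (t : {linear P -> Z}) (t' : {linear P' -> Z'}),
    [/\ forall z, i' (f z) = fP (i z), forall z, i (g z) = gP (i' z),
        forall z, g (f z) - z = t (i z) & forall z, f (g z) - z = t' (i' z)].
Proof.
move=> cov cov' [f [g [gf fg]]].
have [fP [fZ [fPE fZE]]] := cover_lift cov cov' f.
have [gP [gZ [gPE gZE]]] := cover_lift cov' cov g.
have [t tE] := cover_homotopy cov fPE fZE gPE gZE gf.
have [t' t'E] := cover_homotopy cov' gPE gZE fPE fZE fg.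
by exists fZ, gZ, fP, gP, t, t'.
Qed.

Lemma cover_stable (Z P X Z' P' X' : lmodType R)
    (i : {linear Z -> P}) (p : {linear P -> X})
    (i' : {linear Z' -> P'}) (p' : {linear P' -> X'}) :
  projective_presentation i p -> projective_presentation i' p' ->
  stably_iso X X' ->
  stably_iso Z Z'.
Proof.
move=> cov cov' /(cover_stably_iso cov cov').
move=> [f [g [_ [_ [t [t' [_ _ tE t'E]]]]]]].
exists f, g; split; [exists P, i, t|exists P', i', t']; split=> //.
  exact: pc_proj cov.
exact: pc_proj cov'.
Qed.

Definition im_pred U V (f : {linear U -> V}) : {pred V} :=
  [pred v | `[< exists u, v = f u >]].

Fact im_pred_closed U V (f : {linear U -> V}) : submod_closed (im_pred f).
Proof.
split=> [|a x y]; rewrite !inE.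
  by apply/asboolP; exists 0; rewrite linear0.
move=> /asboolP[u ->] /asboolP[v ->]; apply/asboolP; exists (a *: u + v).
by rewrite linearP.
Qed.
HB.instance Definition _ U V (f : {linear U -> V}) :=
  GRing.isSubmodClosed.Build R V (im_pred f) (im_pred_closed f).

Definition coker U V (f : {linear U -> V}) : lmodType R := quotmod (im_pred f).

End LinearAlgebra.

(** * Ext from a projective presentation of a syzygy *)

Section ExtSyzygy.
Variable R : comNzRingType.

Lemma free_eval1 (M : lmodType R) (m : M) : free_eval << 1 *g m >> = m.
Proof. by rewrite free_evalU scale1r. Qed.

Lemma free_evalP (M : lmodType R) a (k l : M) :
  free_eval << 1 *g a *: k + l >> =
    free_eval (a *: << 1 *g k >> + << 1 *g l >> : {malg R[M]}).
Proof. by rewrite linearP /= !free_eval1. Qed.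

Variables (M N : lmodType R) (n : nat).

Definition syzygy_incl : {linear syzygy M n.+1 -> std_res M n} := val.

Lemma std_cover :
  projective_presentation syzygy_incl (@free_eval R (syzygy M n)).
Proof.
split=> [||x|y]; first exact: projective_malg.
- exact: val_inj.
- by exists << 1 *g x >>; exact: free_eval1.
split=> [y0|[z ->]]; last by apply/eqP; exact: valP z.
have yk : y \in ker_pred (@free_eval R (syzygy M n)) by rewrite inE; apply/eqP.
by exists (Sub y yk).
Qed.

(** A cocycle kills the image of [std_diff], which by exactness is the kernel of the surjection
    [free_eval] onto the syzygy; so it descends. *)
Lemma syzygy_fun (x : ker (Ext_diff M N n.+1)) :
  exists u : {linear syzygy M n.+1 -> N},
    forall y, hom_fun (val x) y = u (free_eval y).
Proof.
have x0 y : hom_fun (val x) (std_diff y) = 0.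
  by have /eqP/(congr1 (fun h => hom_fun h y)) := valP x.
have xE y z :
    free_eval y = free_eval z -> hom_fun (val x) y = hom_fun (val x) z.
  move=> yz; apply/eqP; rewrite -subr_eq0 -linearB.
  have [|w ->] := (std_res_exact (y - z)).1; last by apply/eqP; exact: x0.
  apply: (congr1 val (y := 0)); apply/eqP.
  by rewrite linearB subr_eq0; apply/eqP.
have [|u uE] := @linear_bundle _ _ _ (fun k => hom_fun (val x) << 1 *g k >>).
  move=> a k l; rewrite -linearP; apply: xE.
  exact: free_evalP.
by exists u => y; rewrite uE; apply: xE; rewrite free_eval1.
Qed.

(** By [syzygy_fun] a cocycle is a map $u$ on the syzygy, and a coboundary is one that extends to
    the free cover. The isomorphism is $u\mapsto u\circ g$. Its inverse is induced by $f$, because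
    $gf-1$ and $fg-1$ extend to the covers. *)
Theorem Ext_cover (Z P X : lmodType R)
    (i : {linear Z -> P}) (p : {linear P -> X}) :
  projective_presentation i p -> stably_iso (syzygy M n) X ->
  lmod_iso (Ext n.+1 M N) (coker (precomp N i)).
Proof.
move=> cov /(cover_stably_iso std_cover cov).
move=> [f [g [fP [gP [t [t' [fPE gPE tE t'E]]]]]]].
have [u uE] := choice syzygy_fun.
have [|F FE] := @linear_bundle _ (ker (Ext_diff M N n.+1)) (Hom Z N)
    (fun x => hom_of (u x \o g)).
  move=> a x y; apply: homP => z; rewrite hom_funD hom_funZ.
  rewrite -[LHS]/(u _ (g z)) -[RHS]/(a *: u x (g z) + u y (g z)).
  have <- : free_eval << 1 *g g z >> = g z by rewrite free_eval1.
  by rewrite -!uE linearP.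
have FzE x z : hom_fun (F x) z = u x (g z) by rewrite FE.
apply: (quotmod_iso (f := F)) => [x|v].
  rewrite !inE; apply/asboolP/asboolP => [[w Fw]|[k xk]].
    (* If $ug=wi$, then $u=ugf-u(gf-1)=(w\,f_P-u\,t)\circ$ [syzygy_incl]. *)
    exists (hom_of ((hom_fun w \o fP) \- (u x \o t))); apply: homP => y.
    rewrite uE -[RHS]/(hom_fun w (fP (syzygy_incl (free_eval y))) -
       u x (t (syzygy_incl (free_eval y)))).
    rewrite -fPE -tE linearB /= -FzE Fw.
    by rewrite -[hom_fun (precomp _ _ _) _]/(hom_fun w (i _)) opprB addrC subrK.
  exists (hom_of (hom_fun k \o gP)); apply: homP => z.
  rewrite FzE -[RHS]/(hom_fun k (gP (i z))) -gPE.
  have {1}-> : g z = free_eval << 1 *g g z >> by rewrite free_eval1.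
  rewrite -uE xk -[LHS]/(hom_fun k (val (free_eval << 1 *g g z >>))).
  by rewrite free_eval1.
(* The preimage of $v$ is the cocycle of $v\circ f$; its image $vfg$ differs from $v$ by $v\,t'\,i$,
   which extends to [P]. *)
pose h : Hom (std_res M n.+1) N :=
  hom_of (hom_fun v \o (f \o @free_eval R (syzygy M n.+1))).
have hk : h \in ker_pred (Ext_diff M N n.+1).
  rewrite inE; apply/eqP/homP => y.
  rewrite -[LHS]/(hom_fun v (f (free_eval (std_diff y)))).
  have -> : free_eval (std_diff y) = 0.
    by apply/eqP; exact: valP (free_eval y : syzygy M n.+2).
  by rewrite !linear0.
exists (Sub h hk); rewrite inE; apply/asboolP.
exists (hom_of (hom_fun v \o t')).
apply: homP => z; rewrite -[LHS]/(hom_fun (F (Sub h hk)) z - hom_fun v z).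
rewrite -[RHS]/(hom_fun v (t' (i z))) -t'E linearB FzE /=; congr (_ - _).
have {1}-> : g z = free_eval << 1 *g g z >> by rewrite free_eval1.
rewrite -uE -[LHS]/(hom_fun v (f (free_eval << 1 *g g z >>))).
by rewrite free_eval1.
Qed.
End ExtSyzygy.

(** * Ext from an exact sequence of matrices *)

Section MatrixResolution.
Variable R : comNzRingType.

Local Notation mulcV A := (mulmx A : {linear 'cV[R]__ -> 'cV[R]__}).

Definition dot_fun n (v w : 'cV[R]_n) : R^o := (v^T *m w) 0 0.

Fact dot_fun_is_linear n (v : 'cV[R]_n) : linear (dot_fun v).
Proof. by move=> a x y; rewrite /dot_fun mulmxDr -scalemxAr !mxE. Qed.
HB.instance Definition _ n (v : 'cV[R]_n) :=
  GRing.isLinear.Build R 'cV[R]_n R^o *:%R (dot_fun v) (dot_fun_is_linear v).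

Lemma dot_fun_trmx m n (A : 'M[R]_(m, n)) v w :
  dot_fun (A^T *m v) w = dot_fun v (A *m w).
Proof. by rewrite /dot_fun trmx_mul trmxK mulmxA. Qed.

Lemma dot_fun_delta n (v : 'cV[R]_n) i : dot_fun v (delta_mx i 0) = v i 0.
Proof. by rewrite /dot_fun -colE !mxE. Qed.

Lemma dot_fun_inj n (v w : 'cV[R]_n) : dot_fun v =1 dot_fun w -> v = w.
Proof. by move=> vw; apply/colP => i; rewrite -!dot_fun_delta. Qed.

Definition fun_vec n (u : 'cV[R]_n -> R^o) : 'cV[R]_n :=
  \col_i u (delta_mx i 0).

Lemma fun_vecE n (u : {linear 'cV[R]_n -> R^o}) : dot_fun (fun_vec u) =1 u.
Proof.
move=> w; rewrite [in LHS](matrix_sum_delta w) [in RHS](matrix_sum_delta w).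
rewrite !linear_sum; apply: eq_bigr => i _.
by rewrite big_ord1 !linearZ /= dot_fun_delta mxE.
Qed.

Lemma mem_im_mx m n (A : 'M[R]_(m, n)) v :
  reflect (exists u, v = A *m u) (v \in im_mx A).
Proof. by rewrite inE; apply: asboolP. Qed.

Lemma quot_proj_mulmx m n (A : 'M[R]_(m, n)) v :
  quot_proj (im_mx A) (A *m v) = 0.
Proof. by apply/eqP; rewrite quot_proj_eq0; apply/mem_im_mx; exists v. Qed.

(** Exactness makes [A] induce an injection of [coker_mx B] with image $\mathrm{im}\,A$, the kernel
    of the projection onto [coker_mx A]; so [coker_mx B] is a first syzygy of [coker_mx A]. *)
Lemma exact_mx_cover m n p (A : 'M[R]_(m, n)) (B : 'M[R]_(n, p)) :
  (forall v, A *m v = 0 <-> v \in im_mx B) ->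
  exists i : {linear coker_mx B -> 'cV[R]_m},
    (forall v, i (quot_proj (im_mx B) v) = A *m v) /\
    projective_presentation i (quot_proj (im_mx A)).
Proof.
move=> AB.
have [|i iE] := @quotmod_lift R _ (im_mx B) _ (mulmx A) => [v /AB //|].
exists i; split=> //; split=> [|x y|x|y]; first exact: projective_cV.
- have [v ->] := quot_projP x; have [w ->] := quot_projP y.
  rewrite !iE => /eqP; rewrite -subr_eq0 -mulmxBr => /eqP/AB vw.
  by apply/eqP; rewrite quot_proj_eq.
- by have [v ->] := quot_projP x; exists v.
split=> [/eqP|[x ->]].
  rewrite quot_proj_eq0 => /mem_im_mx[v ->].
  by exists (quot_proj (im_mx B) v); rewrite iE.
by have [v ->] := quot_projP x; rewrite iE; exact: quot_proj_mulmx.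
Qed.

(** Functionals on [coker_mx B] are the vectors killed by $B^T$, and those that extend along [i] are
    the vectors $A^Tw$. *)
Lemma coker_precomp_mx m n p (A : 'M[R]_(m, n)) (B : 'M[R]_(n, p))
    (i : {linear coker_mx B -> 'cV[R]_m}) :
  (forall v, i (quot_proj (im_mx B) v) = A *m v) ->
  lmod_iso (coker (precomp R^o i)) (homology (mulcV A^T) (mulcV B^T)).
Proof.
move=> iE.
pose c (u : Hom (coker_mx B) R^o) := fun_vec (hom_fun u \o quot_proj (im_mx B)).
have cE u v : dot_fun (c u) v = hom_fun u (quot_proj (im_mx B) v).
  by rewrite fun_vecE.
have c_ker u : c u \in ker_pred (mulcV B^T).
  rewrite inE; apply/eqP/dot_fun_inj => v.
  by rewrite dot_fun_trmx cE quot_proj_mulmx linear0 /dot_fun trmx0 mul0mx mxE.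
have [|F FE] := @linear_bundle _ _ (ker (mulcV B^T))
    (fun u => Sub (c u) (c_ker u)).
  move=> a u v; apply: val_inj; rewrite -[LHS]/(c _) -[RHS]/(a *: c u + c v).
  by apply/colP => k; rewrite !mxE.
have FcE u : val (F u) = c u by rewrite FE.
apply: (quotmod_iso (f := F)) => [u|[v vB]].
  rewrite !inE; apply/asboolP/asboolP; rewrite FcE => -[w].
    move=> cw; exists (hom_of (dot_fun w)); apply: homP => x.
    have [y ->] := quot_projP x; rewrite -cE cw dot_fun_trmx -iE //.
  move=> uw; exists (fun_vec (hom_fun w)); apply: dot_fun_inj => y.
  rewrite cE uw dot_fun_trmx fun_vecE -iE //.
have [|u uE] := @quotmod_lift R _ (im_mx B) _ (dot_fun v).
  move=> _ /mem_im_mx[w ->]; rewrite -[LHS]/(dot_fun v _) -dot_fun_trmx.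
  move: vB; rewrite inE => /eqP /= ->.
  by rewrite /dot_fun trmx0 mul0mx mxE.
exists (hom_of u).
suff -> : F (hom_of u) = Submod vB by rewrite subrr rpred0.
apply: val_inj; rewrite FcE; apply: dot_fun_inj => y.
by rewrite cE; apply: uE.
Qed.

Section Resolution.
Variables (k : nat -> nat) (A : forall n, 'M[R]_(k n, k n.+1)).
Hypothesis A_exact : forall n v, A n *m v = 0 <-> v \in im_mx (A n.+1).
Variable M : lmodType R.
Hypothesis MA : lmod_iso M (coker_mx (A 0)).

Lemma syzygy_mx_resolution n : stably_iso (syzygy M n) (coker_mx (A n)).
Proof.
elim: n => [|n IHn]; first exact: lmod_iso_stably.
have [i [_ i_cov]] := exact_mx_cover (@A_exact n).
exact: cover_stable (@std_cover R M n) i_cov IHn.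
Qed.

Theorem Ext_mx_resolution n :
  lmod_iso (Ext n.+1 M R^o) (homology (mulcV (A n)^T) (mulcV (A n.+1)^T)).
Proof.
have [i [iE i_cov]] := exact_mx_cover (@A_exact n).
exact: lmod_iso_trans (Ext_cover R^o i_cov (syzygy_mx_resolution n))
  (coker_precomp_mx iE).
Qed.
End Resolution.
End MatrixResolution.

(** * Finitely generated ideals and exactness of the Koszul complex *)

Section Ideals.
Variable R : comNzRingType.
Implicit Types (rs : seq R) (r c : R).

(** Coefficients indexed by [nat] allow sums over an initial segment of the generators to be widened
    to ['I_s] without casts. *)
Lemma mem_ideal_gen rs r :
  (exists c : nat -> R, r = \sum_(i < size rs) c i * rs`_i) <->
  r \in ideal_gen rs.
Proof.
rewrite inE; split=> [[c ->]|/asboolP[c ->]]; first by apply/asboolP; exists c.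
exists (fun i => oapp c 0 (insub i)); apply: eq_bigr => i _.
by rewrite valK.
Qed.

Lemma nonzerodivisor_ideal rs r :
  nonzerodivisor_on (cyclic_mod rs) r <->
  (forall c, r * c \in ideal_gen rs -> c \in ideal_gen rs).
Proof.
split=> [rP c rc|rP m].
  rewrite -(quot_proj_eq0 (ideal_gen rs)); apply/eqP/rP.
  by rewrite -linearZ; apply/eqP; rewrite quot_proj_eq0.
have [c ->] := quot_projP m; rewrite -linearZ => /eqP.
by rewrite quot_proj_eq0 => /rP rc; apply/eqP; rewrite quot_proj_eq0.
Qed.
End Ideals.

Section KoszulExactness.
Variables (R : comNzRingType) (s : nat) (f : s.-tuple R).
Implicit Types (g h : {set 'I_s} -> R) (A B : {set 'I_s}) (x : 'I_s).

Definition sgn_before (x : 'I_s) (B : {set 'I_s}) : R :=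
  (-1) ^+ #|[set y in B | (y < x)%N]|.

Lemma sgn_before0 x : sgn_before x set0 = 1.
Proof. by rewrite /sgn_before eq_card0 // => y; rewrite !inE. Qed.

(** The Koszul differential on chains encoded as functions on all subsets, with no fixed degree; the
    value at [B] is the coefficient of $e_B$. *)
Definition koszul_bd g B : R :=
  \sum_(x | x \notin B) sgn_before x B * tnth f x * g (x |: B).

Lemma koszul_bdE g B : \sum_A koszul_coef f B A * g A = koszul_bd g B.
Proof.
under eq_bigr => A _ do rewrite mulr_suml big_mkcond /=.
rewrite exchange_big [RHS]big_mkcond; apply: eq_bigr => x _ /=.
rewrite -big_mkcond /=; have [xB|xB] := boolP (x \in B); rewrite /=.
  rewrite big_pred0 // => A; apply/negP => /andP[_ /eqP eB].
  by move: xB; rewrite -eB !inE eqxx.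
rewrite (big_pred1 (x |: B)) => [|A /=].
  congr (_ ^+ _ * _ * _); apply: eq_card => y; rewrite !inE.
  by have [->|] := eqVneq; rewrite //= ltnn andbF.
apply/andP/eqP => [[xA /eqP <-]|->]; first by rewrite setD1K.
by rewrite setU11 setU1K.
Qed.

Lemma koszul_bdD g h B :
  koszul_bd (fun A => g A + h A) B = koszul_bd g B + koszul_bd h B.
Proof. by rewrite -big_split; apply: eq_bigr => x _; rewrite mulrDr. Qed.

Lemma koszul_bdZ c g B : koszul_bd (fun A => c * g A) B = c * koszul_bd g B.
Proof. by rewrite mulr_sumr; apply: eq_bigr => x _; rewrite mulrCA. Qed.

Lemma eq_koszul_bd g h : g =1 h -> koszul_bd g =1 koszul_bd h.
Proof. by move=> gh B; apply: eq_bigr => x _; rewrite gh. Qed.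

(* g lies in the i-th term of the Koszul complex of the first n entries of f. *)
Definition koszul_supp n i g : Prop :=
  forall A, g A != 0 -> #|A| = i /\ (forall x, x \in A -> (x < n)%N).

Lemma koszul_suppD n i g h : koszul_supp n i g -> koszul_supp n i h ->
  koszul_supp n i (fun A => g A + h A).
Proof.
move=> gS hS A; have [->|/gS //] := eqVneq (g A) 0.
by rewrite add0r; apply: hS.
Qed.

Lemma koszul_suppZ n i c g : koszul_supp n i g ->
  koszul_supp n i (fun A => c * g A).
Proof.
move=> gS A; have [->|/gS //] := eqVneq (g A) 0.
by rewrite mulr0 eqxx.
Qed.

Lemma koszul_supp_card n i g A : koszul_supp n i g -> #|A| != i -> g A = 0.
Proof. by move=> gS Ai; apply: contraNeq Ai => /gS[->]. Qed.

Lemma koszul_supp_high n i g A x : koszul_supp n i g -> x \in A -> (n <= x)%N ->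
  g A = 0.
Proof.
by move=> gS xA; rewrite leqNgt; apply: contraNeq => /gS[_]; apply.
Qed.

Lemma koszul_bd_high n i g B x : koszul_supp n i g -> x \in B -> (n <= x)%N ->
  koszul_bd g B = 0.
Proof.
move=> gS xB nx; rewrite /koszul_bd big1 // => y _.
by rewrite (koszul_supp_high gS _ nx) ?mulr0 // !inE xB orbT.
Qed.

Lemma koszul_bd_card n i g B : koszul_supp n i g -> #|B|.+1 != i ->
  koszul_bd g B = 0.
Proof.
move=> gS Bi; rewrite /koszul_bd big1 // => y yB.
by rewrite (koszul_supp_card gS) ?mulr0 // cardsU1 yB.
Qed.

Section Wedge.
Variable e : 'I_s.

(* The wedge product of h with the basis vector of index e; there is no sign  *)
(* because h will only involve indices less than e.                           *)
Definition wedge h A : R := if e \in A then h (A :\ e) else 0.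

Lemma eq_wedge g h : g =1 h -> wedge g =1 wedge h.
Proof. by move=> gh A; rewrite /wedge gh. Qed.

Lemma koszul_supp_wedge i h :
  koszul_supp e i h -> koszul_supp e.+1 i.+1 (wedge h).
Proof.
move=> hS A; rewrite /wedge; case: ifP => [eA /hS[<- Ae]|]; last first.
  by rewrite eqxx.
split=> [|x xA]; first by rewrite (cardsD1 e) eA.
have [->//|xe] := eqVneq x e; rewrite ltnS ltnW // Ae // !inE xe //.
Qed.

Lemma koszul_supp_widen i h : koszul_supp e i h -> koszul_supp e.+1 i h.
Proof. by move=> hS A /hS[Ai Ae]; split=> // x /Ae/ltnW. Qed.

(** The Leibniz rule $\partial(h\wedge e)=\partial h\wedge e+(-1)^i f_e h$. As [e] exceeds every
    index in [h], removing it costs the sign $(-1)^i$ and removing another index has the same sign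
    as in [h]. *)
Lemma koszul_bd_wedge i h : koszul_supp e i h ->
  forall B, koszul_bd (wedge h) B =
    wedge (koszul_bd h) B + (-1) ^+ i * tnth f e * h B.
Proof.
move=> hS B; rewrite {2}/wedge; case: ifPn => eB.
  rewrite (koszul_supp_high hS eB) // mulr0 addr0.
  rewrite /koszul_bd [RHS](bigD1 e) /=; last by rewrite !inE eqxx.
  rewrite (@koszul_supp_high _ _ _ (e |: _) e hS) ?setU11 // mulr0 add0r.
  apply: eq_big => [x|x xB].
    by rewrite !inE; have [->|] := eqVneq x e; rewrite ?eB ?andbT.
  have xe : x != e by apply: contraNneq xB => ->.
  have -> : wedge h (x |: B) = h (x |: (B :\ e)).
    rewrite /wedge !inE eB orbT; congr h; apply/setP => y; rewrite !inE.
    by have [->|] := eqVneq y x; rewrite ?xe.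
  have [->|/hS[_ /(_ x)]] := eqVneq (h (x |: B :\ e)) 0.
    by rewrite !mulr0.
  rewrite setU11 => /(_ isT) lxe; congr (_ ^+ _ * _ * _).
  apply: eq_card => y; rewrite !inE.
  by have [->|] := eqVneq y e; rewrite //= ltnNge (ltnW lxe) andbF.
rewrite add0r /koszul_bd (bigD1 e) //= big1 ?addr0 => [|x /andP[_ xe]].
  rewrite /wedge setU11 setU1K //.
  have [->|/hS[<- Be]] := eqVneq (h B) 0; first by rewrite !mulr0.
  congr (_ ^+ _ * _ * _); apply: eq_card => y; rewrite !inE.
  by have [/Be ->|] := boolP (y \in B).
by rewrite /wedge !inE (negPf eB) eq_sym (negPf xe) mulr0.
Qed.
End Wedge.

(** The coefficients that express [g set0] in the generators are the entries of the 1-chain. *)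
Lemma koszul_degree0 n g : (n <= s)%N -> koszul_supp n 0 g ->
  g set0 \in ideal_gen (take n f) ->
  exists h, koszul_supp n 1 h /\ koszul_bd h =1 g.
Proof.
move=> ns gS /mem_ideal_gen; rewrite size_takel ?size_tuple // => -[c gE].
pose d x : R := if (x < n)%N then c x else 0.
pose h A : R := \sum_(x | A == [set x]) d x.
have h1 x : h [set x] = d x.
  rewrite /h (big_pred1 x) // => y /=; apply/eqP/eqP => [/set1_inj //|-> //].
have h0 A : #|A| != 1%N -> h A = 0.
  move=> A1; rewrite /h big_pred0 // => x; apply: contraNF A1 => /eqP ->.
  by rewrite cards1.
exists h; split=> [A|B].
  have [/eqP/cards1P[x ->]|/h0 ->] := eqVneq #|A| 1%N; last by rewrite eqxx.
  rewrite cards1 h1 /d; case: ifP => [xn _|]; last by rewrite eqxx.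
  by split=> // y /set1P ->.
have [->|B0] := eqVneq B set0; last first.
  rewrite (koszul_supp_card gS) ?cards_eq0 // /koszul_bd big1 // => x xB.
  by rewrite h0 ?mulr0 // cardsU1 xB eqSS cards_eq0.
rewrite gE /koszul_bd.
rewrite (big_ord_widen s (fun i => c i * (take n f)`_i)) // [RHS]big_mkcond.
apply: eq_big => [x|x _]; first by rewrite inE.
rewrite setU0 h1 sgn_before0 mul1r /d; case: ifP => xn; last by rewrite mulr0.
by rewrite nth_take // (tnth_nth 0) mulrC.
Qed.

Lemma koszul_bd_ideal n g : (n <= s)%N -> koszul_supp n 1 g ->
  koszul_bd g set0 \in ideal_gen (take n f).
Proof.
move=> ns gS; apply/mem_ideal_gen; rewrite size_takel ?size_tuple //.
pose c i := oapp (fun x : 'I_s => g [set x]) 0 (insub i).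
exists c; rewrite (big_ord_widen s (fun i => c i * (take n f)`_i)) //.
rewrite [RHS]big_mkcond; apply: eq_big => [x|x _]; first by rewrite inE.
rewrite setU0 sgn_before0 mul1r /c valK /=; case: ifP => xn.
  by rewrite nth_take // (tnth_nth 0) mulrC.
by rewrite (koszul_supp_high gS (set11 x)) ?mulr0 // leqNgt xn.
Qed.

Section Exactness.
Hypothesis f_reg : regular_sequence f.

(** Induction on [n], by the mapping cone of $f_e$. Split a cycle as $g=g_a+g_b\wedge e$ with [e] in
    neither part. Then $\partial g_b=0$ and $\partial g_a=-(-1)^i f_e g_b$. Writing $g_b=\partial
    h_b$ makes $g_a+(-1)^i f_e h_b$ a cycle on fewer indices, hence some $\partial h_a$, and
    $h_a+h_b\wedge e$ bounds $g$. *)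
Lemma koszul_bd_exact n : (n <= s)%N -> forall i g, koszul_supp n i.+1 g ->
  (forall B, koszul_bd g B = 0) ->
  exists h, koszul_supp n i.+2 h /\ koszul_bd h =1 g.
Proof.
elim: n => [_|n IHn ns] i g gS g0.
  exists (fun=> 0); split=> [A|B]; first by rewrite eqxx.
  rewrite /koszul_bd big1 => [|x _]; last by rewrite mulr0.
  apply/esym/eqP/negPn/negP => /gS[/eqP + B0].
  suff -> : B = set0 by rewrite cards0.
  by apply/setP => x; rewrite inE; apply/negP => /B0.
pose e := Ordinal ns.
pose ga A := if e \in A then 0 else g A.
pose gb A := if e \in A then 0 else g (e |: A).
have gE A : g A = ga A + wedge e gb A.
  rewrite /ga /gb /wedge; case: ifP => eA; last by rewrite addr0.
  by rewrite !inE eqxx /= add0r setD1K.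
have lt_n x : x != e -> (x < n.+1)%N -> (x < n)%N.
  by rewrite ltnS leq_eqVlt -[(x : nat) == n]/(x == e) => /negPf->.
have gaS : koszul_supp e i.+1 ga.
  move=> A; rewrite /ga; case: ifPn => [|eA /gS[Ai An]]; first by rewrite eqxx.
  split=> // x xA; apply: lt_n (An _ xA).
  by apply: contraNneq eA => <-.
have gbS : koszul_supp e i gb.
  move=> A; rewrite /gb; case: ifPn => [|eA /gS[]]; first by rewrite eqxx.
  rewrite cardsU1 eA => -[Ai An]; split=> // x xA; apply: lt_n.
    by apply: contraNneq eA => <-.
  by apply: An; rewrite !inE xA orbT.
have bdg B : koszul_bd ga B + wedge e (koszul_bd gb) B
    + (-1) ^+ i * tnth f e * gb B = 0.
  by rewrite -addrA -(koszul_bd_wedge gbS) -koszul_bdD -(eq_koszul_bd gE) g0.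
have bdgb B : koszul_bd gb B = 0.
  have [eB|eB] := boolP (e \in B); first exact: koszul_bd_high gbS eB _.
  (* At a subset containing [e] only the middle term of [bdg] survives. *)
  have := bdg (e |: B).
  rewrite (koszul_bd_high gaS (setU11 _ _)) //.
  rewrite (koszul_supp_high gbS (setU11 _ _)) //.
  by rewrite /wedge setU11 setU1K // add0r mulr0 addr0.
have bdga B : koszul_bd ga B + (-1) ^+ i * tnth f e * gb B = 0.
  by rewrite -[RHS](bdg B) /wedge bdgb if_same addr0.
have [hb [hbS hbE]] : exists h, koszul_supp n i.+1 h /\ koszul_bd h =1 gb.
  (* In positive degree [gb] is a boundary by induction. In degree 0 regularity is needed: $f_e
     g_b(\emptyset)=-\partial g_a(\emptyset)$ lies in the ideal of the earlier entries, hence so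
     does $g_b(\emptyset)$. *)
  case: i => [|i] in gaS gbS bdga gS bdg *; last first.
    exact: IHn (ltnW ns) _ _ gbS bdgb.
  apply: koszul_degree0 (ltnW ns) gbS _.
  apply: ((nonzerodivisor_ideal _ _).1 (@f_reg e)).
  have -> : tnth f e * gb set0 = - koszul_bd ga set0.
    by apply/eqP; rewrite -addr_eq0 addrC -[tnth f e]mul1r bdga.
  rewrite -mulN1r; apply: rpredZ; exact: koszul_bd_ideal (ltnW ns) gaS.
(* [hb] has degree one more than [gb], so its Leibniz term is [- c * hb] and cancels the correction
   added to [ga]. *)
pose c : R := (-1) ^+ i * tnth f e.
have [|B|ha [haS haE]] := IHn (ltnW ns) i (fun A => ga A + c * hb A).
- exact: koszul_suppD gaS (koszul_suppZ hbS).
- by rewrite koszul_bdD koszul_bdZ hbE bdga.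
exists (fun A => ha A + wedge e hb A); split=> [|B].
  exact: koszul_suppD (@koszul_supp_widen e _ _ haS)
    (@koszul_supp_wedge e _ _ hbS).
rewrite koszul_bdD haE (@koszul_bd_wedge e _ _ hbS) (eq_wedge _ hbE) [RHS]gE.
by rewrite exprS mulN1r !mulNr addrA addrAC addrK.
Qed.

Definition koszul_vec i g : 'cV[R]_(koszul_rank s i) := \col_a g (enum_val a).

Lemma koszul_d_vec i g : (forall A, g A != 0 -> #|A| = i) ->
  koszul_d f i *m koszul_vec i g = koszul_vec i.-1 (koszul_bd g).
Proof.
move=> gi; apply/colP => b; rewrite !mxE -koszul_bdE.
transitivity (\sum_(A in isubsets s i) koszul_coef f (enum_val b) A * g A).
  by rewrite [RHS]big_enum_val; apply: eq_bigr => a _; rewrite !mxE.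
rewrite big_mkcond; apply: eq_bigr => A _; rewrite inE.
case: eqP => // Ai; have [->|/gi //] := eqVneq (g A) 0.
by rewrite mulr0.
Qed.

(** Extension of [v] by zero to subsets of other cardinals; the sum has at most one term. *)
Definition koszul_cochain i (v : 'cV[R]_(koszul_rank s i)) A : R :=
  \sum_(a | enum_val a == A) v a 0.

Lemma koszul_cochainE i (v : 'cV[R]_(koszul_rank s i)) :
  koszul_vec i (koszul_cochain v) = v.
Proof.
apply/colP => a; rewrite mxE /koszul_cochain (big_pred1 a) // => b.
by rewrite /= (inj_eq enum_val_inj).
Qed.

Lemma koszul_cochain_supp i (v : 'cV[R]_(koszul_rank s i)) :
  koszul_supp s i (koszul_cochain v).
Proof.
move=> A vA; split=> [|x _]; last exact: ltn_ord.
apply/eqP; apply: contraNT vA => Ai; rewrite /koszul_cochain big_pred0 // => a.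
apply: contraNF Ai => /eqP <-.
by have := enum_valP a; rewrite inE.
Qed.

Lemma koszul_exact i v :
  koszul_d f i.+1 *m v = 0 <-> v \in im_mx (koszul_d f i.+2).
Proof.
split=> [v0|/mem_im_mx[w ->]]; last by rewrite mulmxA koszul_dd mul0mx.
have vS := @koszul_cochain_supp _ v.
have [B|h [hS hE]] := koszul_bd_exact (leqnn s) vS.
  have [/eqP Bi|Bi] := eqVneq #|B|.+1 i.+1; last exact: koszul_bd_card vS Bi.
  have Bi' : B \in isubsets s i by rewrite inE.
  move: v0; rewrite -[v in _ *m v]koszul_cochainE koszul_d_vec; last first.
    by move=> A /vS[].
  by move=> /colP/(_ (enum_rank_in Bi' B)); rewrite !mxE enum_rankK_in.
apply/mem_im_mx; exists (koszul_vec i.+2 h).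
rewrite (@koszul_d_vec i.+2) => [|A /hS[] //].
by rewrite -{1}[v]koszul_cochainE; apply/colP => a; rewrite !mxE hE.
Qed.
End Exactness.
End KoszulExactness.

(** * Self-duality of the Koszul complex *)

Section KoszulDuality.
Variables (R : comNzRingType) (s : nat) (f : s.-tuple R).
Implicit Types (A B : {set 'I_s}) (x : 'I_s).

(* The product of the signs that x carries in A and in ~: (A :\ x) is         *)
(* (-1)^x, which is eps A * eps (A :\ x).                                     *)
Definition eps A : R := (-1) ^+ \sum_(x in A) x.

Lemma epsM A : eps A * eps A = 1.
Proof. by rewrite -expr2 sqrr_sign. Qed.

Lemma sgn_before_compl A x : x \in A ->
  sgn_before R x A = eps A * eps (A :\ x) * sgn_before R x (~: (A :\ x)).
Proof.
move=> xA; have -> : eps A = (-1) ^+ x * eps (A :\ x).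
  by rewrite {1}/eps (big_setD1 x) //= exprD.
rewrite -[_ * _ * eps _]mulrA epsM mulr1 /sgn_before.
(* The indices below [x] number exactly [x]: [a] of them lie in [A], and [b] outside [A]. *)
set a := #|_|; set b := #|_|; suff -> : nat_of_ord x = (a + b)%N.
  by rewrite exprD -mulrA -expr2 sqrr_sign mulr1.
have -> : nat_of_ord x = #|[set y : 'I_s | (y < x)%N]|.
  rewrite -sum1dep_card -(big_ord_widen s (fun=> 1%N)) 1?ltnW //.
  by rewrite sum1_card card_ord.
rewrite -(cardsID A); congr (_ + _)%N; apply: eq_card => y; rewrite !inE.
  by rewrite andbC.
by have [->|] := eqVneq y x; rewrite /= ?ltnn ?andbF.
Qed.

Lemma koszul_coef_compl A B :
  koszul_coef f B A = eps A * eps B * koszul_coef f (~: A) (~: B).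
Proof.
rewrite mulr_sumr; apply: eq_big => [x|x /andP[xA /eqP <-]]; last first.
  by rewrite mulrA -sgn_before_compl.
have DC (E : {set 'I_s}) : x \in E -> ~: (E :\ x) :\ x = ~: E.
  move=> xE; apply/setP => y; rewrite !inE.
  by have [->|] := eqVneq y x; rewrite ?xE.
apply/andP/andP => -[]; first by move=> xA /eqP <-; rewrite DC // !inE eqxx.
move=> xB /eqP BA; rewrite -[A]setCK -BA -[B in _ == B]setCK DC //.
by rewrite !inE eqxx.
Qed.

(** A Hodge star $e_A\mapsto\pm e_{A^c}$ with sign [eps]. Both degrees are parameters, tied by
    hypotheses [i + m = s], to avoid casts along [s - i]. *)
Definition koszul_star i m : 'M[R]_(koszul_rank s m, koszul_rank s i) :=
  \matrix_(b, a) (eps (enum_val a) *+ (enum_val b == ~: enum_val a)).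

Lemma sum_enum_val1 i A (h : {set 'I_s} -> R) : #|A| = i ->
  \sum_(a < koszul_rank s i) h (enum_val a) *+ (enum_val a == A) = h A.
Proof.
move=> Ai; transitivity (\sum_(B in isubsets s i) h B *+ (B == A)).
  by rewrite [RHS]big_enum_val.
rewrite (bigD1 A) /=; last by rewrite inE Ai.
by rewrite eqxx big1 ?addr0 // => B /andP[_ /negPf->].
Qed.

Lemma card_enum_val i (a : 'I_(koszul_rank s i)) : #|enum_val a| = i.
Proof. by have := enum_valP a; rewrite inE => /eqP. Qed.

Lemma card_compl i m A : (i + m = s)%N -> #|A| = i -> #|~: A| = m.
Proof.
by move=> ims Ai; apply/eqP; rewrite -(eqn_add2l i) -{1}Ai cardsC card_ord ims.
Qed.

Lemma eqC_sym A B : (A == ~: B) = (B == ~: A).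
Proof. by rewrite -(inj_eq (@setC_inj _)) setCK eq_sym. Qed.

Lemma koszul_starE i m n (M : 'M[R]_(koszul_rank s i, n)) h b c :
  (i + m = s)%N -> (forall a, M a c = h (enum_val a)) ->
  (koszul_star i m *m M) b c = eps (~: enum_val b) * h (~: enum_val b).
Proof.
move=> ims Mh; have Cb := card_compl (etrans (addnC _ _) ims) (card_enum_val b).
rewrite mxE -(sum_enum_val1 (fun A => eps A * h A) Cb).
by apply: eq_bigr => a _; rewrite !mxE Mh eqC_sym mulrnAl.
Qed.

(** Entrywise this is [koszul_coef_compl]: the star is a chain map from the transposed complex to
    the complex. *)
Lemma koszul_star_d i m : (i + m.+1 = s)%N ->
  koszul_star i.+1 m *m (koszul_d f i.+1)^T =
    koszul_d f m.+1 *m koszul_star i m.+1.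
Proof.
move=> ims; apply/matrixP => c b.
rewrite (koszul_starE (h := fun A => koszul_coef f (enum_val b) A)).
- rewrite mxE koszul_coef_compl mulrA mulrA epsM mul1r setCK mulrC.
  rewrite -(sum_enum_val1
    (fun E => koszul_coef f (enum_val c) E * eps (enum_val b))
    (card_compl ims (card_enum_val b))).
  by apply: eq_bigr => a _; rewrite !mxE mulrnAr.
- by rewrite addSnnS.
by move=> a; rewrite !mxE.
Qed.

Lemma koszul_starV i m : (i + m = s)%N ->
  koszul_star i m *m (koszul_star i m)^T = 1%:M.
Proof.
move=> ims; apply/matrixP => b c.
rewrite (koszul_starE (h := fun A => eps A *+ (enum_val c == ~: A))) //.
  by rewrite setCK !mxE mulrnAr epsM (inj_eq enum_val_inj) eq_sym.
by move=> a; rewrite !mxE.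
Qed.

Lemma koszul_Vstar i m : (i + m = s)%N ->
  (koszul_star i m)^T *m koszul_star i m = 1%:M.
Proof.
move=> ims; apply/matrixP => b c; rewrite mxE.
rewrite -[RHS](_ : eps (enum_val b) * (eps (enum_val c) *+
   (~: enum_val b == ~: enum_val c)) = _); last first.
  rewrite (inj_eq (@setC_inj _)) (inj_eq enum_val_inj) mxE.
  by case: eqP => [->|]; rewrite ?epsM ?mulr0n ?mulr0.
rewrite -(sum_enum_val1 (fun B => eps (enum_val b) * (eps (enum_val c) *+
  (B == ~: enum_val c))) (card_compl ims (card_enum_val b))).
by apply: eq_bigr => a _; rewrite !mxE mulrnAl.
Qed.

Lemma koszul_d_star i m : (i + m.+1 = s)%N ->
  (koszul_d f i.+1)^T *m (koszul_star i m.+1)^T =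
    (koszul_star i.+1 m)^T *m koszul_d f m.+1.
Proof.
move=> ims; have i1ms : (i.+1 + m = s)%N by rewrite addSnnS.
rewrite -[LHS]mul1mx -(koszul_Vstar i1ms).
rewrite -[LHS]mulmxA [X in _ *m X = _]mulmxA koszul_star_d //.
by rewrite -[X in _ *m X = _]mulmxA koszul_starV // mulmx1.
Qed.

Lemma coker_koszul_trmx i m : (i + m.+1 = s)%N ->
  lmod_iso (coker_mx (koszul_d f i.+1)^T) (coker_mx (koszul_d f m.+1)).
Proof.
move=> ims; have i1ms : (i.+1 + m = s)%N by rewrite addSnnS.
apply: (@quotmod_iso _ _ _ _ _ (mulmx (koszul_star i.+1 m))) => [u|v].
  apply/mem_im_mx/mem_im_mx => -[w uw]; last first.
    exists (koszul_star i m.+1 *m w).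
    by rewrite uw /= !mulmxA koszul_star_d.
  exists ((koszul_star i m.+1)^T *m w).
  rewrite -[u]mul1mx -(koszul_Vstar i1ms) -mulmxA [X in _ *m X = _]uw.
  by rewrite !mulmxA koszul_d_star.
exists ((koszul_star i.+1 m)^T *m v).
by rewrite /= mulmxA koszul_starV // mul1mx subrr rpred0.
Qed.

(** The star moves the claim to exactness of the Koszul complex in degree $s-i-1$, which is positive
    since $i+1<s$. *)
Lemma koszul_trmx_exact i v : regular_sequence f -> (i.+1 < s)%N ->
  (koszul_d f i.+2)^T *m v = 0 <-> v \in im_mx (koszul_d f i.+1)^T.
Proof.
move=> f_reg lt_is; pose m := (s - i.+2)%N.
have ims : (i.+1 + m.+1 = s)%N by rewrite /m; lia.
have i2ms : (i.+2 + m = s)%N by rewrite addSnnS.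
have im2s : (i + m.+2 = s)%N by rewrite -addSnnS.
split=> [v0|/mem_im_mx[w ->]]; last first.
  by rewrite mulmxA -trmx_mul koszul_dd trmx0 mul0mx.
have /(koszul_exact f_reg)/mem_im_mx[w vw] :
    koszul_d f m.+1 *m (koszul_star i.+1 m.+1 *m v) = 0.
  by rewrite mulmxA -koszul_star_d // -mulmxA v0 mulmx0.
apply/mem_im_mx; exists ((koszul_star i m.+2)^T *m w).
rewrite -[v]mul1mx -(koszul_Vstar ims) -mulmxA vw.
by rewrite !mulmxA koszul_d_star.
Qed.

(** $K_0$ has rank one, spanned by the empty subset, and there the image of $d_1$ is the ideal, by
    [koszul_bd_ideal] and [koszul_degree0]. *)
Lemma coker_koszul1 : lmod_iso (cyclic_mod f) (coker_mx (koszul_d f 1)).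
Proof.
have [|F FE] := @linear_bundle R R^o 'cV[R]_(koszul_rank s 0)
    (fun r => const_mx r).
  by move=> a x y; apply/colP => i; rewrite !mxE.
have r0 : set0 \in isubsets s 0 by rewrite inE cards0.
have ev0 (b : 'I_(koszul_rank s 0)) : enum_val b = set0.
  by apply/eqP; rewrite -cards_eq0 card_enum_val.
have f_take : take s f = f by rewrite take_oversize ?size_tuple.
apply: (quotmod_iso (f := F)) => [r|v]; last first.
  exists (v (enum_rank_in r0 set0) 0); rewrite FE.
  suff -> : const_mx (v (enum_rank_in r0 set0) 0) = v by rewrite subrr rpred0.
  apply/colP => b; rewrite mxE; congr (v _ 0); apply: enum_val_inj.
  by rewrite !ev0.
rewrite FE; apply/mem_im_mx/idP => [[w rw]|].
  have wS := @koszul_cochain_supp R s 1 w.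
  move: rw; rewrite -[w]koszul_cochainE.
  rewrite (@koszul_d_vec R s f 1) => [|A /wS[] //].
  move=> /colP/(_ (enum_rank_in r0 set0)); rewrite !mxE ev0 => ->.
  by have := koszul_bd_ideal f (leqnn s) wS; rewrite f_take.
move=> rf; have {}rf : r \in ideal_gen (take s f) by rewrite f_take.
pose g A : R := r *+ (A == set0).
have [A|//|h [hS hE]] := @koszul_degree0 R s f s g (leqnn s).
- rewrite /g; have [-> _|_] := eqVneq A set0; last by rewrite eqxx.
  by rewrite cards0; split=> // x; rewrite inE.
- by rewrite /g eqxx.
exists (koszul_vec 1 h).
rewrite (@koszul_d_vec R s f 1) => [|A /hS[] //].
by apply/colP => b; rewrite !mxE hE /g ev0 eqxx.
Qed.

Lemma koszul_high_eq0 i (v : 'cV[R]_(koszul_rank s i)) : (s < i)%N -> v = 0.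
Proof.
move=> si; apply/colP => a; have := card_enum_val a.
move: (max_card (enum_val a)); rewrite card_ord.
by move=> /leq_ltn_trans/(_ si)/ltn_eqF/eqP.
Qed.
End KoszulDuality.

(** * Ext of the cokernels of the Koszul differentials *)

Section ExtKoszul.
Variables (R : comNzRingType).
Local Notation mulcV A := (mulmx A : {linear 'cV[R]__ -> 'cV[R]__}).

Lemma homology_mx0 m n p (A : 'M[R]_(m, n)) (B : 'M[R]_(p, m)) :
  (forall v : 'cV_m, B *m v = 0 -> v \in im_mx A) ->
  is_zero_mod (homology (mulcV A) (mulcV B)).
Proof.
move=> AB x; have [[v vB] ->] := quot_projP x; apply/eqP.
rewrite quot_proj_eq0 inE; apply/asboolP.
by apply/mem_im_mx/AB/eqP.
Qed.

Lemma homology_mx_coker m n p (A : 'M[R]_(m, n)) (B : 'M[R]_(p, m)) :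
  (forall v : 'cV_m, B *m v = 0) ->
  lmod_iso (homology (mulcV A) (mulcV B)) (coker_mx A).
Proof.
move=> B0; have vB v : v \in ker_pred (mulcV B).
  by rewrite inE; apply/eqP; exact: B0.
apply: (@quotmod_iso _ _ _ _ _ (val : {linear ker (mulcV B) -> 'cV_m})).
  by move=> u; rewrite !inE.
move=> v; exists (Submod (vB v)).
by rewrite /= subrr rpred0.
Qed.

Theorem Ext_koszul s (f : s.-tuple R) j (M : lmodType R) l :
  regular_sequence f -> (j < s)%N -> (0 < l)%N ->
  lmod_iso M (coker_mx (koszul_d f j.+1)) ->
  (l = (s - j)%N -> lmod_iso (Ext l M R^o) (cyclic_mod f)) /\
  (l <> (s - j)%N -> is_zero_mod (Ext l M R^o)).
Proof.
move=> f_reg lt_js; case: l => // l _ Mj.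
have := @Ext_mx_resolution R (fun n => koszul_rank s (n + j))
  (fun n => koszul_d f (n + j).+1)
  (fun n => koszul_exact f_reg (i := n + j)) M Mj l.
move=> ExtE; split=> [lE|lN].
  (* The homology is taken at $K_s$: the outgoing map lands in $K_{s+1}=0$, leaving the cokernel of
     $d_s^T$. *)
  have lj : ((l + j).+1 = s)%N by lia.
  apply: lmod_iso_trans ExtE _.
  apply: lmod_iso_trans (homology_mx_coker _ _) _ => [v|].
    by apply: koszul_high_eq0; lia.
  apply: lmod_iso_trans (lmod_iso_sym (coker_koszul1 f)).
  by apply: coker_koszul_trmx; rewrite addn1.
apply: is_zero_mod_iso ExtE _; apply: homology_mx0 => v.
(* Below $K_s$ the transposed complex is exact; otherwise the position is beyond $K_s$, where the
   module is zero. *)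
have [lt_ls|le_sl] := ltnP (l + j).+1 s.
  exact: (koszul_trmx_exact v f_reg lt_ls).1.
move=> _; rewrite (koszul_high_eq0 v) ?rpred0 //; lia.
Qed.
End ExtKoszul.

(** * Conjugation, the Koszul code and the theorem *)

Section Conjugation.
Variables (K : comNzRingType) (D : nat).
Local Notation L := (laurent K D).
Local Notation conj := (@lconj K D).

(** The semilinear map [c] becomes linear once its target carries the conjugate action. *)
Lemma bar_quotmod (V W : lmodType L) (P : submodClosed V) (Q : submodClosed W)
    (c : W -> V) :
  (forall a x y, c (a *: x + y) = conj a *: c x + c y) ->
  (forall v, exists w, c w = v) -> (forall w, (c w \in P) = (w \in Q)) ->
  lmod_iso (bar (quotmod P)) (quotmod Q).
Proof.
move=> c_lin c_surj cPQ; apply: lmod_iso_sym.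
have [|q qE] := @linear_bundle L W (bar (quotmod P))
    (fun w => Bar (quot_proj P (c w))).
  by move=> a x y; apply: val_inj; rewrite /= c_lin linearP.
have q0 w : q w = 0 <-> w \in Q.
  rewrite -cPQ -quot_proj_eq0 qE; split=> [/(congr1 (@unbar _ _ _)) /= -> //|].
  by move=> /eqP cw; apply: val_inj.
have [|g gE] := @quotmod_lift L W Q _ q; first by move=> w /q0.
apply: (bijective_linear (f := g)) => [x|[y]].
  have [w ->] := quot_projP x; rewrite gE => /q0 wQ.
  by apply/eqP; rewrite quot_proj_eq0.
have [v ->] := quot_projP y; have [w <-] := c_surj v.
by exists (quot_proj Q w); rewrite gE qE.
Qed.

Lemma map_lconjK m n (A : 'M[L]_(m, n)) : map_mx conj (map_mx conj A) = A.
Proof. by apply/matrixP => i j; rewrite !mxE lconjK. Qed.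

Lemma map_lconj_dagger m n (A : 'M[L]_(m, n)) : map_mx conj (dagger A) = A^T.
Proof. by apply/matrixP => i j; rewrite !mxE lconjK. Qed.

Lemma bar_coker_mx m n (A : 'M[L]_(m, n)) :
  lmod_iso (bar (coker_mx A)) (coker_mx (map_mx conj A)).
Proof.
apply: (@bar_quotmod _ _ _ _ (map_mx conj)) => [a x y|v|w].
- by rewrite map_mxD map_mxZ.
- by exists (map_mx conj v); rewrite map_lconjK.
apply/mem_im_mx/mem_im_mx => -[u uE]; exists (map_mx conj u).
  by rewrite -[LHS]map_lconjK uE map_mxM.
by rewrite uE map_mxM map_lconjK.
Qed.

Lemma ideal_gen_conj (rs : seq L) r :
  (conj r \in ideal_gen rs) = (r \in ideal_gen (map conj rs)).
Proof.
apply/idP/idP => /mem_ideal_gen[c rE]; apply/mem_ideal_gen;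
  exists (conj \o c); rewrite ?size_map in rE *.
  rewrite -[LHS]lconjK rE rmorph_sum; apply: eq_bigr => i _.
  by rewrite rmorphM (nth_map 0).
rewrite rE rmorph_sum; apply: eq_bigr => i _.
by rewrite rmorphM (nth_map 0) //= lconjK.
Qed.

Lemma bar_cyclic_mod (rs : seq L) :
  lmod_iso (bar (cyclic_mod rs)) (cyclic_mod (map conj rs)).
Proof.
apply: (@bar_quotmod L^o L^o (ideal_gen rs) (ideal_gen (map conj rs)) conj)
  => [a x y|v|w].
- by rewrite rmorphD rmorphM.
- by exists (conj v); rewrite lconjK.
exact: ideal_gen_conj.
Qed.

Variables (s : nat) (f : s.-tuple L).

Lemma regular_sequence_conj :
  regular_sequence f -> regular_sequence (map_tuple conj f).
Proof.
move=> f_reg i; apply/nonzerodivisor_ideal => c.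
rewrite tnth_map -map_take -!ideal_gen_conj rmorphM /= lconjK.
exact: (nonzerodivisor_ideal _ _).1 (@f_reg i) _.
Qed.

Lemma koszul_d_conj i :
  koszul_d (map_tuple conj f) i = map_mx conj (koszul_d f i).
Proof.
apply/matrixP => b a; rewrite !mxE /koszul_coef rmorph_sum.
by apply: eq_bigr => x _; rewrite rmorphM rmorphXn rmorphN1 tnth_map.
Qed.

Lemma dagger_koszul_d i :
  dagger (koszul_d f i) = (koszul_d (map_tuple conj f) i)^T.
Proof. by rewrite koszul_d_conj. Qed.

Lemma koszul_code_topological j : regular_sequence f -> (0 < j < s)%N ->
  topological (koszul_code f j).
Proof.
case: j => // j f_reg /= lt_js; split=> v; rewrite [RHS]inE.
  have := koszul_trmx_exact v (regular_sequence_conj f_reg) lt_js.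
  by rewrite -!dagger_koszul_d => vE; apply/idP/eqP => /vE.
rewrite daggerK.
by apply/idP/eqP => /(koszul_exact f_reg v).
Qed.

(** [bar] undoes the conjugation in the dagger, so [f] itself appears here, while its conjugate
    appears for [phiZ]. *)
Lemma bar_coker_phiX i m : (i + m.+1 = s)%N ->
  lmod_iso (bar (coker_mx (phiX (koszul_code f i.+1))))
    (coker_mx (koszul_d f m.+1)).
Proof.
move=> ims; apply: lmod_iso_trans (bar_coker_mx _) _.
by rewrite [phiX _]/(dagger _) map_lconj_dagger; apply: coker_koszul_trmx.
Qed.

Lemma bar_coker_phiZ j :
  lmod_iso (bar (coker_mx (phiZ (koszul_code f j))))
    (coker_mx (koszul_d (map_tuple conj f) j.+1)).
Proof. by rewrite koszul_d_conj; apply: bar_coker_mx. Qed.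
End Conjugation.

Theorem fact1 (N D s j : nat) (f : s.-tuple (laurent 'Z_N D)) :
  (1 < N)%N ->
  regular_sequence f ->
  (1 <= j <= s - 1)%N ->
  let R := laurent 'Z_N D in
  let S := cyclic_mod f in
  let C := koszul_code f j in
  [/\ topological C,
      forall l : nat, (0 < l)%N ->
        let E := Ext l (bar (coker_mx (phiX C))) R^o in
        (l = j -> lmod_iso E S) /\ (l <> j -> is_zero_mod E)
    & forall l : nat, (0 < l)%N ->
        let E := Ext l (bar (coker_mx (phiZ C))) R^o in
        (l = (s - j)%N -> lmod_iso E (bar S)) /\
        (l <> (s - j)%N -> is_zero_mod E)].
Proof.
move=> _ f_reg; case: j => // i lt_is R S C.
have {}lt_is : (i.+1 < s)%N by lia.
split=> [|l l0 E|l l0 E]; first exact: koszul_code_topological.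
  (* The cokernel becomes that of $d_{m+1}$ with $m=s-j$, so Ext sits in degree $s-m=j$. *)
  pose m := (s - i.+1)%N; have ims : (i + m.+1 = s)%N by rewrite /m; lia.
  have lt_ms : (m < s)%N by rewrite /m; lia.
  have jE : i.+1 = (s - m)%N by rewrite /m; lia.
  by rewrite jE; apply: Ext_koszul => //; apply: bar_coker_phiX.
have [Ej E0] := Ext_koszul (regular_sequence_conj f_reg) lt_is l0
  (bar_coker_phiZ f i.+1).
split=> // lE; apply: lmod_iso_trans (Ej lE) _.
exact/lmod_iso_sym/bar_cyclic_mod.
Qed.
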